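(* Let $M$ be a compact conformal manifold of dimension $m=2r$, $r\ge 1$, let $(N,h)$ be a Riemannian manifold, and let $\varphi\colon M\to (N,h)$ be a smooth $r$-conformal map. If $\varphi$ is a local (resp. global) minimiser of volume, then $\varphi$ is a local (resp. global) minimum of $\mathcal E_r$ with respect to any Riemannian metric $g$ in the conformal class of $M$. In particular, $\varphi$ is an $r$-harmonic map with respect to any such $g$.
   Context: A conformal manifold is a smooth manifold with a conformal class of Riemannian metrics. Given $g$ in this class and a smooth map $\psi\colon M\to N$, let $\alpha$ be the $g$-self-adjoint $(1,1)$-tensor with $g(\alpha(X),Y)=h(d\psi(X),d\psi(Y))$; let $\varepsilon_r(\psi)$ be the $r$-th elementary symmetric polynomial of the eigenvalues of $\alpha$, and $v(\psi)=\sqrt{\det\alpha}$ the volume density. The $r$-th energy is $\mathcal E_r(\psi)=\frac12\int_M\varepsilon_r(\psi)\,\mathrm{vol}(g)$ and the volume of $\psi$ is $\int_M v(\psi)\,\mathrm{vol}(g)$ (which is independent of the choice of $g$). Minimisation is over smooth maps $M\to N$: global over all of them, local over those in a neighbourhood of $\varphi$ (in the same topology for both functionals). The map $\varphi$ is $r$-conformal if $\varphi$ is conformal on an open subset $U\subseteq M$ (i.e. $\varphi^*h=\rho^2g$ on $U$ with $\rho>0$) and $\operatorname{rank}d\varphi_x<r$ for all $x\in M\setminus U$. The map $\varphi$ is $r$-harmonic if it is a critical point of $\mathcal E_r$ with respect to smooth variations. *)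

(* Defs.v *)
From HB Require Import structures.
From mathcomp Require Import all_boot all_order all_algebra.
From mathcomp Require Import all_classical all_reals all_analysis.
Import Order.TTheory GRing.Theory Num.Theory.
Import numFieldNormedType.Exports.

Set Implicit Arguments.
Unset Strict Implicit.
Unset Printing Implicit Defensive.

Local Open Scope classical_set_scope.
Local Open Scope ring_scope.

(* Vectors are row vectors, so the differential of a map acts by
   [v |-> v *m J] with [J] the library Jacobian, and a bilinear form of
   matrix [G] is [(v, w) |-> v *m G *m w^T]. *)

(* [U] is meant to be open. *)
Fixpoint Cn_on (R : realType) (V W : normedModType R) (k : nat)
    (U : set V) (f : V -> W) : Prop :=
  if k is k'.+1 then
    (forall x, U x -> differentiable f x) /\
    (forall v, Cn_on k' U (fun x => 'D_v f x))
  else forall x, U x -> {for x, continuous f}.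

Definition smooth_on (R : realType) (V W : normedModType R)
    (U : set V) (f : V -> W) : Prop := forall k, Cn_on k U f.

(* The partial derivative of [f] along the coordinate directions listed
   in [s]. *)
Definition partials (R : realType) (m : nat) (W : normedModType R)
    (s : seq 'I_m) (f : 'rV[R]_m -> W) : 'rV[R]_m -> W :=
  foldr (fun a F x => 'D_(delta_mx 0 a : 'rV[R]_m) F x) f s.

(* A nonempty Hausdorff second countable space with a smooth atlas, which need
   not be maximal.  The base point of the carrier only expresses nonemptiness,
   which the library requires of measurable spaces.  [chart] and [chart_inv]
   are meaningful on [dom i] and [chart i @` dom i] only. *)
Record manifold (R : realType) (m : nat) := Manifold {
  mcarrier :> ptopologicalType ;
  chart_index : Type ;
  dom : chart_index -> set mcarrier ;
  chart : chart_index -> mcarrier -> 'rV[R]_m ;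
  chart_inv : chart_index -> 'rV[R]_m -> mcarrier ;
  mhausdorff : hausdorff_space mcarrier ;
  msecond_countable : @second_countable mcarrier ;
  dom_open : forall i, open (dom i) ;
  chart_open : forall i, open (chart i @` dom i) ;
  chartK : forall i p, dom i p -> chart_inv i (chart i p) = p ;
  chart_continuous : forall i p, dom i p -> {for p, continuous (chart i)} ;
  chart_inv_continuous : forall i y, (chart i @` dom i) y ->
    {for y, continuous (chart_inv i)} ;
  dom_cover : forall p, exists i, dom i p ;
  transition_smooth : forall i j,
    smooth_on (chart i @` (dom i `&` dom j)) (chart j \o chart_inv i)
}.

Arguments chart_index {R m} _.
Arguments dom {R m} _ _.
Arguments chart {R m} _ _ _.
Arguments chart_inv {R m} _ _ _.

(* The index of some chart around [p]; the quantities defined with it below do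
   not depend on this choice. *)
Definition chart_at (R : realType) (m : nat) (M : manifold R m) (p : M) :
  chart_index M := projT1 (cid (dom_cover p)).

Section Maps.
Variables (R : realType) (m n : nat) (M : manifold R m) (N : manifold R n).

Definition local_repr (f : M -> N) (i : chart_index M) (j : chart_index N) :
    'rV[R]_m -> 'rV[R]_n :=
  chart N j \o f \o chart_inv M i.

Definition smooth (f : M -> N) : Prop :=
  continuous f /\
  forall i j, smooth_on (chart M i @` (dom M i `&` f @^-1` dom N j))
                        (local_repr f i j).

Record smooth_map := SmoothMap {
  smooth_fun :> M -> N ;
  smooth_funP : smooth smooth_fun
}.

(* The matrix of the differential of [f] at [p] in the charts [i] and [j]. *)
Definition differential (f : M -> N) (i : chart_index M) (j : chart_index N)
    (p : M) : 'M[R]_(m, n) :=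
  jacobian (local_repr f i j) (chart M i p).

(* [F t] for [`|t| < e] is a smooth variation of [f]: [F] is smooth as a map
   from [(-e, e) * M] to [N]. *)
Definition smooth_variation (f : M -> N) (e : R) (F : R -> M -> N) : Prop :=
  [/\ 0 < e,
      F 0 = f,
      forall (t : R) (p : M), `|t| < e ->
        {for (t, p), continuous (fun q : R * M => F q.1 q.2)} &
      forall i j, smooth_on
        [set z : (R^o * 'rV[R]_m)%type | exists t p,
           [/\ `|t| < e, dom M i p, dom N j (F t p) & z = (t, chart M i p)]]
        (fun z : (R^o * 'rV[R]_m)%type =>
           chart N j (F z.1 (chart_inv M i z.2)))].

Definition is_topology (tau : set (set smooth_map)) : Prop :=
  [/\ tau setT,
      forall A B, tau A -> tau B -> tau (A `&` B) &
      forall F : set (set smooth_map), F `<=` tau ->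
        tau (\bigcup_(A in F) A)].

(* A subbasic neighbourhood of [f] for the smooth (weak Whitney) topology:
   uniform closeness, on a compact subset of a chart, of the partial
   derivatives up to a given order. *)
Definition smooth_subbasic (f : smooth_map) (B : set smooth_map) : Prop :=
  exists i j (K : set M) (k : nat) (e : R),
  [/\ compact K, K `<=` dom M i, K `<=` f @^-1` dom N j, 0 < e &
      B = [set u : smooth_map | forall p, K p -> dom N j (u p) /\
             forall s : seq 'I_m, (size s <= k)%N ->
               `|partials s (local_repr u i j) (chart M i p) -
                 partials s (local_repr f i j) (chart M i p)| < e]].

Definition smooth_topology : set (set smooth_map) :=
  [set O | forall f, O f ->
     exists (l : nat) (B : 'I_l -> set smooth_map),
       (forall a, smooth_subbasic f (B a)) /\
       \bigcap_(a in [set: 'I_l]) B a `<=` O].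

Definition global_minimiser (E : (M -> N) -> R) (f : smooth_map) : Prop :=
  forall u : smooth_map, E f <= E u.

Definition local_minimiser (tau : set (set smooth_map)) (E : (M -> N) -> R)
    (f : smooth_map) : Prop :=
  exists O, [/\ tau O, O f & forall u : smooth_map, O u -> E f <= E u].

Definition critical_point (E : (M -> N) -> R) (f : smooth_map) : Prop :=
  forall (e : R) (F : R -> M -> N), smooth_variation f e F ->
    is_derive (0 : R) (1 : R) (fun t => E (F t)) 0.

End Maps.

Arguments is_topology {R m n M N} _.

(* [g i p] is the matrix of the metric at [p] in the chart [i]. *)
Record metric (R : realType) (m : nat) (M : manifold R m) := Metric {
  metric_mx :> chart_index M -> M -> 'M[R]_m ;
  metric_sym : forall i p, dom M i p -> (metric_mx i p)^T = metric_mx i p ;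
  metric_pos : forall i p, dom M i p -> forall v : 'rV[R]_m, v != 0 ->
    0 < (v *m metric_mx i p *m v^T) 0 0 ;
  metric_smooth : forall i,
    smooth_on (chart M i @` dom M i) (metric_mx i \o chart_inv M i) ;
  metric_compat : forall i j p, dom M i p -> dom M j p ->
    let T := jacobian (chart M j \o chart_inv M i) (chart M i p) in
    metric_mx i p = T *m metric_mx j p *m T^T
}.

(* The conformal factor is necessarily smooth, being a quotient of components
   of smooth metrics. *)
Definition conformally_equivalent (R : realType) (m : nat)
    (M : manifold R m) (g g' : metric M) : Prop :=
  exists2 c : M -> R, (forall p, 0 < c p) &
    forall i p, dom M i p -> g' i p = c p *: g i p.

Record conformal_class (R : realType) (m : nat) (M : manifold R m) :=
  ConformalClass {
  in_class : set (metric M) ;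
  class_nonempty : exists g, in_class g ;
  classP : forall g g', in_class g ->
    (in_class g' <-> conformally_equivalent g g')
}.

(* Lebesgue integral over R^m of a nonnegative Borel function, as an iterated
   integral (Tonelli). *)
Fixpoint integral_rV (R : realType) (m : nat) :
    ('rV[R]_m -> \bar R) -> \bar R :=
  match m with
  | 0 => fun f => f 0
  | m'.+1 => fun f =>
      (\int[@lebesgue_measure R]_x
         @integral_rV R m'
           (fun y => f (row_mx (x%:M : 'M[R]_1) y : 'rV[R]_(1 + m'))))%E
  end.

Definition borel (T : ptopologicalType) := g_sigma_algebraType (@open T).

(* In each chart, [mu] is [sqrt (det g) dx]. *)
Definition is_riemannian_measure (R : realType) (m : nat)
    (M : manifold R m) (g : metric M)
    (mu : {measure set (borel M) -> \bar R}) : Prop :=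
  forall i (A : set (borel M)), measurable A -> A `<=` dom M i ->
    mu A = integral_rV (fun y : 'rV[R]_m =>
      (\1_(chart M i @` A) y *
       Num.sqrt (\det (g i (chart_inv M i y))))%:E).

(* vol(g): by the change of variables formula and second countability, there
   is exactly one such measure, so the default value is never used. *)
Definition vol (R : realType) (m : nat) (M : manifold R m) (g : metric M) :
    {measure set (borel M) -> \bar R} :=
  match pselect (exists mu, is_riemannian_measure g mu) with
  | left ex => projT1 (cid ex)
  | right _ => mzero
  end.

(* The eigenvalues with multiplicity, in some order, of a matrix whose
   characteristic polynomial splits over [R]. *)
Definition eigenvalues (R : realType) (m : nat) (A : 'M[R]_m) : seq R :=
  xget [::] [set s : seq R | char_poly A = \prod_(a <- s) ('X - a%:P)].

Definition elementary_symmetric (R : realType) (r : nat) (s : seq R) : R :=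
  \sum_(I : {set 'I_(size s)} | #|I| == r) \prod_(i in I) s`_i.

Section Energies.
Variables (R : realType) (m n : nat) (M : manifold R m) (N : manifold R n).
Implicit Types (g : metric M) (h : metric N) (f : M -> N).

(* The matrix of f^*h at [p] in the chart [i]. *)
Definition pullback h f (i : chart_index M) (p : M) : 'M[R]_m :=
  let j := chart_at (f p) in
  let D := differential f i j p in D *m h j (f p) *m D^T.

(* The matrix A (acting on row vectors) with A *m g = f^*h, i.e.
   g(v *m A, w) = h(df v, df w). *)
Definition alpha g h f (p : M) : 'M[R]_m :=
  let i := chart_at p in pullback h f i p *m invmx (g i p).

Definition epsilon (r : nat) g h f (p : M) : R :=
  elementary_symmetric r (eigenvalues (alpha g h f p)).

Definition volume_density g h f (p : M) : R :=
  Num.sqrt (\det (alpha g h f p)).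

Definition energy (r : nat) g h f : R :=
  2^-1 * (\int[vol g]_(p in [set: borel M]) epsilon r g h f p)%R.

Definition volume g h f : R :=
  (\int[vol g]_(p in [set: borel M]) volume_density g h f p)%R.

Definition conformal_on g h f (U : set M) : Prop :=
  exists rho : M -> R, forall p, U p -> 0 < rho p /\
    forall i, dom M i p -> pullback h f i p = rho p ^+ 2 *: g i p.

(* Conformality does not depend on the metric chosen in the class. *)
Definition r_conformal (r : nat) (C : conformal_class M) h f : Prop :=
  exists2 g, in_class C g & exists U : set M,
    [/\ open U, conformal_on g h f U &
        forall p, ~ U p ->
          (\rank (differential f (chart_at p) (chart_at (f p)) p) < r)%N].

Definition r_harmonic (r : nat) g h (f : smooth_map M N) : Prop :=
  critical_point (energy r g h) f.

End Energies.

(* Main.v *)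
(* Pointwise, pairing each set of r eigenvalues of alpha with its complement and
   using AM-GM gives epsilon_r >= C(2r, r) v, with equality where f^*h is a
   multiple of g and where df has rank < r.  Since the volume does not depend
   on the metric in the conformal class, an r-conformal minimiser of the volume
   therefore minimises E_r.  A nonnegative symmetric second difference
   E_r(F_t) + E_r(F_(-t)) - 2 E_r(F_0) = o(t) then shows that E_r is critical. *)

Require Import Defs.
From HB Require Import structures.
From mathcomp Require Import all_boot all_order all_algebra.
From mathcomp Require Import all_classical all_reals all_analysis.
From mathcomp Require Import measurable_realfun ring lra.
From mathcomp Require complex.
Import Order.TTheory GRing.Theory Num.Theory.
Import numFieldNormedType.Exports.
Set Implicit Arguments.
Unset Strict Implicit.
Unset Printing Implicit Defensive.
Local Open Scope classical_set_scope.
Local Open Scope ring_scope.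

(** * Eigenvalues of the strain tensor *)

Section LinearAlgebra.
Variable R : realType.

(** The list [eigenvalues] comes from a choice and depends on the point without any regularity.
    Every analytic statement therefore goes through the characteristic polynomial: up to sign, the
    r-th symmetric function is its coefficient of degree m - r, hence locally a polynomial in the
    entries of f^*h and g divided by [\det g]. Continuity, first order expansion in time and
    vanishing at low rank are all read off from this coefficient. The measure [vol g] is also
    obtained by choice and is known only through iterated integrals in charts. A conformal change g'
    = c g is handled by showing that the measure of density c^r with respect to a Riemannian measure
    of g is Riemannian for g'; compactness gives uniqueness and so identifies it with [vol g']. The
    exponent r is half the dimension, and it cancels the factor c^(-r) gained by the volume
    density. *)

Lemma elementary_symmetricE (r : nat) (s : seq R) : (r <= size s)%N ->
  elementary_symmetric r s =
  (-1) ^+ r * (\prod_(a <- s) ('X - a%:P))`_(size s - r).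
Proof.
move=> rs; rewrite coef_prod_XsubC ?leq_subr// subKn// mulrA -exprD -signr_odd.
by rewrite oddD addbb mul1r.
Qed.

Lemma le_elementary_symmetric (r : nat) (s : seq R) : size s = (2 * r)%N ->
  (forall a, a \in s -> 0 <= a) ->
  'C(2 * r, r)%:R * Num.sqrt (\prod_(a <- s) a) <= elementary_symmetric r s.
Proof.
move=> ss s0.
have F0 (i : 'I_(size s)) : 0 <= s`_i by apply/s0/mem_nth.
pose q := Num.sqrt (\prod_(a <- s) a).
pose f (I : {set 'I_(size s)}) := \prod_(i in I) s`_i.
have f0 I : 0 <= f I by apply: prodr_ge0.
have fC I : 2 * q <= f I + f (~: I).
  have -> : q = Num.sqrt (f I) * Num.sqrt (f (~: I)).
    rewrite -sqrtrM// /q; congr (Num.sqrt _).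
    rewrite (big_nth 0) big_mkord (bigID (mem I))/=; congr (_ * _).
    by apply: eq_bigl => i; rewrite inE.
  have := sqr_ge0 (Num.sqrt (f I) - Num.sqrt (f (~: I))).
  by rewrite sqrrB !sqr_sqrtr// mulr_natl addrAC subr_ge0.
(* There are exactly 2r eigenvalues, so complementation permutes the r-subsets; adding the two forms
   of the sum produces the pairs bounded by [fC]. *)
have E2 : elementary_symmetric r s =
    \sum_(I : {set 'I_(size s)} | #|I| == r) f (~: I).
  rewrite /elementary_symmetric (reindex_inj (inv_inj (@finset.setCK _)))/=.
  apply: eq_bigl => I.
  have h := etrans (cardsC I) (etrans (card_ord _) ss).
  by rewrite -(eqn_add2l #|I|) h mul2n -addnn eqn_add2r eq_sym.
have : \sum_(I : {set 'I_(size s)} | #|I| == r) (2 * q) <=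
       elementary_symmetric r s + elementary_symmetric r s.
  rewrite [X in _ <= _ + X]E2 -big_split/=; apply: ler_sum => I _; exact: fC.
have -> : \sum_(I : {set 'I_(size s)} | #|I| == r) (2 * q) = (2 * q) *+ 'C(2 * r, r).
  have <- : #|[set I : {set 'I_(size s)} | #|I| == r]%SET| = 'C(2 * r, r).
    by rewrite card_draws card_ord ss.
  by rewrite -sumr_const; apply: eq_bigl => I; rewrite inE.
rewrite -mulr2n -[X in _ <= X]mulr_natl.
by rewrite -mulr_natl mulrCA ler_pM2l// ltr0n.
Qed.

Import complex.

(** The two equations are the real and imaginary parts of v P = z v G for v = x + iy and z = a + ib.
    Symmetry of P gives b (G(x,x) + G(y,y)) = 0, and adding P(x,x) and P(y,y) gives a (G(x,x) +
    G(y,y)) >= 0. *)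
Lemma generalized_eigenvalue (m : nat) (G P : 'M[R]_m) (x y : 'rV[R]_m) (a b : R) :
  G^T = G -> (forall v : 'rV[R]_m, v != 0 -> 0 < (v *m G *m v^T) 0 0) ->
  P^T = P -> (forall v : 'rV[R]_m, 0 <= (v *m P *m v^T) 0 0) ->
  (x != 0) || (y != 0) ->
  x *m P = a *: (x *m G) - b *: (y *m G) ->
  y *m P = a *: (y *m G) + b *: (x *m G) ->
  b = 0 /\ 0 <= a.
Proof.
move=> Gs Gp Ps Pp xy0 xP yP.
pose B (A : 'M[R]_m) (u v : 'rV[R]_m) : R := (u *m A *m v^T) 0 0.
have Bs (A : 'M[R]_m) u v : A^T = A -> B A u v = B A v u.
  move=> As; rewrite /B -[in LHS](trmxK (u *m A *m v^T)) [LHS]mxE.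
  by rewrite !trmx_mul trmxK As mulmxA.
have G0 v : 0 <= B G v v.
  have [->|/Gp/ltW//] := eqVneq v 0; by rewrite /B !mul0mx mxE.
have E1 v : B P x v = a * B G x v - b * B G y v.
  by rewrite /B xP mulmxBl -!scalemxAl !mxE.
have E2 v : B P y v = a * B G y v + b * B G x v.
  by rewrite /B yP mulmxDl -!scalemxAl !mxE.
have S0 : 0 < B G x x + B G y y.
  case/orP: xy0 => /Gp h; [exact: ltr_pwDl|exact: ltr_wpDl].
have b0 : b = 0.
  have := Bs P x y Ps; rewrite E1 E2 (Bs G x y)// => /eqP.
  rewrite -subr_eq0 opprD addrACA subrr add0r -opprD oppr_eq0 -mulrDr.
  by rewrite mulf_eq0 [in X in _ || X]addrC (gt_eqF S0) orbF => /eqP.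
split=> //.
have := addr_ge0 (Pp x) (Pp y); rewrite -/(B P x x) -/(B P y y) E1 E2 b0.
by rewrite !mul0r subr0 addr0 -mulrDr pmulr_lge0.
Qed.

(* A complex eigenvector x + iy reduces the claim to the previous lemma. *)
Lemma char_poly_split (m : nat) (G P : 'M[R]_m) :
  G^T = G -> (forall v : 'rV[R]_m, v != 0 -> 0 < (v *m G *m v^T) 0 0) ->
  P^T = P -> (forall v : 'rV[R]_m, 0 <= (v *m P *m v^T) 0 0) ->
  G \in unitmx /\
  exists2 s : seq R, (forall a, a \in s -> 0 <= a) &
    char_poly (P *m invmx G) = \prod_(a <- s) ('X - a%:P).
Proof.
move=> Gs Gp Ps Pp.
have Gu : G \in unitmx.
  rewrite -row_free_unit -kermx_eq0; apply/rowV0P => v /sub_kermxP vG.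
  apply/eqP/negP => /negP /Gp; by rewrite vG mul0mx mxE ltxx.
split=> //.
pose f : {rmorphism R -> R[i]} := real_complex R.
pose A := P *m invmx G.
have [s Hs] := closed_field_poly_normal (char_poly (map_mx f A)).
move: Hs; rewrite (monicP (char_poly_monic _)) scale1r => Hs.
have key z : z \in s -> Im z = 0 /\ 0 <= Re z.
  move=> zs; have : root (char_poly (map_mx f A)) z by rewrite Hs root_prod_XsubC.
  rewrite -eigenvalue_root_char => /eigenvalueP[v vA v0].
  have {}vA : v *m map_mx f P = z *: (v *m map_mx f G).
    rewrite scalemxAl -vA -mulmxA -map_mxM; congr (_ *m map_mx _ _).
    by rewrite /A -mulmxA mulVmx// mulmx1.
  pose x := map_mx (@Re R) v; pose y := map_mx (@Im R) v.
  have ReM (M : 'M[R]_m) : map_mx (@Re R) (v *m map_mx f M) = x *m M.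
    apply/rowP => j; rewrite !mxE raddf_sum/=; apply: eq_bigr => k _.
    rewrite !mxE; case: (v 0 k) => p q /=; by rewrite mulr0 subr0.
  have ImM (M : 'M[R]_m) : map_mx (@Im R) (v *m map_mx f M) = y *m M.
    apply/rowP => j; rewrite !mxE raddf_sum/=; apply: eq_bigr => k _.
    rewrite !mxE; case: (v 0 k) => p q /=; by rewrite mulr0 add0r.
  have [||//|] := @generalized_eigenvalue m G P x y (Re z) (Im z) Gs Gp Ps Pp.
  - apply: contraNT v0; rewrite negb_or !negbK => /andP[/eqP x0 /eqP y0].
    apply/eqP/rowP => k; rewrite mxE.
    move: (congr1 (fun w : 'rV_m => w 0 k) x0) (congr1 (fun w : 'rV_m => w 0 k) y0).
    by rewrite !mxE; case: (v 0 k) => p q /= -> ->.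
  - rewrite -ReM vA -!ReM -!ImM; apply/rowP => k; rewrite !mxE.
    by case: z {zs vA} => p q; case: (\sum_j _) => p' q' /=.
  - rewrite -ImM vA -!ReM -!ImM; apply/rowP => k; rewrite !mxE.
    by case: z {zs vA} => p q; case: (\sum_j _) => p' q' /=.
  - by [].
exists [seq Re z | z <- s].
  by move=> a /mapP[z /key[_ z0] ->].
(* All complex roots are real by [key], so the factorization over [R[i]] is the image of one over
   [R]. *)
apply: (@map_poly_inj _ _ f); rewrite [LHS]map_char_poly Hs map_prod_XsubC big_map.

rewrite !big_seq; apply: eq_bigr => z /key[z0 _].
by congr ('X - _%:P); case: z z0 => p q /= ->.
Qed.

Definition nonneg_spectrum (m : nat) (A : 'M[R]_m) :=
  exists2 s : seq R, (forall a, a \in s -> 0 <= a) &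
    char_poly A = \prod_(a <- s) ('X - a%:P).

(** A product of monic linear factors determines its roots and its length, so these properties pass
    to whichever list [eigenvalues] selects. *)
Lemma nonneg_spectrum_eigenvalues (m : nat) (A : 'M[R]_m) :
  nonneg_spectrum A ->
  [/\ (forall a, a \in eigenvalues A -> 0 <= a), size (eigenvalues A) = m &
      char_poly A = \prod_(a <- eigenvalues A) ('X - a%:P)].
Proof.
move=> [s s0 As].
have E : char_poly A = \prod_(a <- eigenvalues A) ('X - a%:P).
  by rewrite /eigenvalues; apply: (@xgetPex _ [::]
    [set s : seq R | char_poly A = \prod_(a <- s) ('X - a%:P)]); exists s.
split=> //.
  by move=> a; rewrite -root_prod_XsubC -E As root_prod_XsubC; exact: s0.
by have := size_char_poly A; rewrite E size_prod_XsubC => -[].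
Qed.

Lemma elementary_symmetric_eigenvalues (m r : nat) (A : 'M[R]_m) : (r <= m)%N ->
  nonneg_spectrum A ->
  elementary_symmetric r (eigenvalues A) = (-1) ^+ r * (char_poly A)`_(m - r).
Proof.
move=> rm /nonneg_spectrum_eigenvalues[_ sz E].
by rewrite elementary_symmetricE ?sz// -E.
Qed.

Lemma det_prod_eigenvalues (m : nat) (A : 'M[R]_m) : nonneg_spectrum A ->
  \det A = \prod_(a <- eigenvalues A) a.
Proof.
move=> /nonneg_spectrum_eigenvalues[_ sz E].
have := char_poly_det A; rewrite E coef0_prod_XsubC sz => /esym.
by apply: mulfI; rewrite signr_eq0.
Qed.

Lemma elementary_symmetric_ge_sqrt_det (r : nat) (A : 'M[R]_(2 * r)) :
  nonneg_spectrum A ->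
  'C(2 * r, r)%:R * Num.sqrt (\det A) <= elementary_symmetric r (eigenvalues A).
Proof.
move=> Ap; have [p sz _] := nonneg_spectrum_eigenvalues Ap.
by rewrite det_prod_eigenvalues//; exact: le_elementary_symmetric.
Qed.

(** The characteristic polynomial allows replacing the selected list by the constant one. Every term
    is then a^r, which is the square root of a^(2r) because a is nonnegative. *)
Lemma elementary_symmetric_scalar (r : nat) (a : R) : 0 <= a ->
  elementary_symmetric r (eigenvalues (a%:M : 'M[R]_(2 * r))) =
  'C(2 * r, r)%:R * Num.sqrt (\det (a%:M : 'M[R]_(2 * r))).
Proof.
move=> a0; set A := a%:M.
have E : char_poly A = \prod_(b <- nseq (2 * r) a) ('X - b%:P).
  rewrite char_poly_trig ?scalar_mx_is_trig// big_nseq iter_mulr_1.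
  by rewrite -[in RHS](card_ord (2 * r)) -prodr_const; apply: eq_bigr => i _; rewrite mxE eqxx.
have Ap : nonneg_spectrum A.
  by exists (nseq (2 * r) a) => // b; rewrite mem_nseq => /andP[_ /eqP->].
have [_ sz Ee] := nonneg_spectrum_eigenvalues Ap.
have r2 : (r <= 2 * r)%N by rewrite leq_pmull.
rewrite elementary_symmetric_eigenvalues// E.
have := @elementary_symmetricE r (nseq (2 * r) a).
rewrite size_nseq => /(_ r2) <-; rewrite /elementary_symmetric.
rewrite (eq_bigr (fun=> a ^+ r)) => [|I /eqP Ir]; last first.
  rewrite (eq_bigr (fun=> a)); first by rewrite prodr_const Ir.
  by move=> i _; rewrite nth_nseq -[X in (_ < X)%N](size_nseq (2 * r) a) ltn_ord.
rewrite det_scalar [in a ^+ (2 * r)%N]mulnC exprM sqrtr_sqr ger0_norm ?exprn_ge0//.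
have <- : #|[set I : {set 'I_(size (nseq (2 * r) a))} | #|I| == r]%SET| = 'C(2 * r, r).
  by rewrite card_draws card_ord size_nseq.
rewrite mulr_natl -sumr_const; apply: eq_bigl => I; by rewrite inE.
Qed.

Lemma char_poly_det_eq (m : nat) (A B : 'M[R]_m) :
  char_poly A = char_poly B -> \det A = \det B.
Proof.
move=> AB; apply: (mulfI (_ : (-1) ^+ m != 0)); first by rewrite signr_eq0.
by rewrite -!char_poly_det AB.
Qed.

(** Conjugacy is stated as an intertwining relation to keep inverses out of the polynomial matrices;
    [\det T] cancels as a nonzero constant. *)
Lemma char_poly_intertwine (m : nat) (A B T : 'M[R]_m) : T \in unitmx ->
  A *m T = T *m B -> char_poly A = char_poly B.
Proof.
move=> Tu AT; pose T' := map_mx polyC T.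
have : char_poly_mx A *m T' = T' *m char_poly_mx B.
  rewrite /char_poly_mx mulmxBl mulmxBr scalar_mxC; congr (_ - _).
  by rewrite -!map_mxM AT.
move=> /(congr1 determinant); rewrite !det_mulmx mulrC; apply: mulfI.
by rewrite det_map_mx polyC_eq0 -unitfE -unitmxE.
Qed.

(* Up to conjugation the last [m - \rank A] rows of [A] vanish, so
   ['X^(m - \rank A)] divides its characteristic polynomial. *)
Lemma char_poly_coef_rank (m k : nat) (A : 'M[R]_m) : (k + \rank A < m)%N ->
  (char_poly A)`_k = 0.
Proof.
move=> kA; set q := \rank A in kA.
pose B : 'M[R]_m := pid_mx q *m (row_ebase A *m col_ebase A).
have -> : char_poly A = char_poly B.
  apply: (char_poly_intertwine (col_ebase_unit A)).
  by rewrite -[X in X *m _](mulmx_ebase A) /B !mulmxA.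
have Brow (i j : 'I_m) : (q <= i)%N -> B i j = 0.
  move=> qi; rewrite mxE big1// => l _.
  by rewrite !mxE ltnNge qi andbF mul0r.
move: B Brow => B Brow.
(* A zero row of [B] leaves only 'X on the diagonal of its characteristic matrix: [D] collects these
   factors and [E] keeps a row of the identity in their place. *)
pose D : 'rV[{poly R}]_m := \row_i (if (i < q)%N then 1 else 'X).
pose E : 'M[{poly R}]_m :=
  \matrix_(i, j) (if (i < q)%N then char_poly_mx B i j else (i == j)%:R).
rewrite /char_poly; have -> : char_poly_mx B = diag_mx D *m E.
  apply/matrixP => i j; rewrite mul_diag_mx !mxE.
  case: ltnP => [_|qi]; first by rewrite mul1r.
  by rewrite Brow// subr0 mulr_natr.
rewrite det_mulmx det_diag.
have -> : \prod_i D 0 i = 'X^(m - q).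
  have qm : (q <= m)%N by rewrite (leq_trans _ (ltnW kA))// leq_addl.
  under eq_bigr do rewrite mxE.
  rewrite -(big_mkord xpredT (fun i => if (i < q)%N then 1 else 'X)).
  rewrite (big_cat_nat _ qm)//= big_nat big1 ?mul1r => [|i /andP[_ ->]]//.
  rewrite big_nat (eq_bigr (fun=> 'X)) => [|i /andP[qi _]]; last by rewrite ltnNge qi.
  by rewrite -big_nat prodr_const_nat.
by rewrite coefXnM ltn_subRL addnC kA.
Qed.
End LinearAlgebra.

(* [Q] stands for a regularity property of real functions on [T] (continuity,
   differentiability...) stable under the ring operations. *)
Section FunctionRing.
Variables (R : realType) (T : Type) (Q : (T -> R) -> Prop).
Hypothesis Qcst : forall c, Q (fun=> c).
Hypothesis QD : forall f g, Q f -> Q g -> Q (fun x => f x + g x).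
Hypothesis QM : forall f g, Q f -> Q g -> Q (fun x => f x * g x).

Lemma fring_sum (I : Type) (s : seq I) (P : pred I) (f : I -> T -> R) :
  (forall i, Q (f i)) -> Q (fun x => \sum_(i <- s | P i) f i x).
Proof.
move=> Qf; elim: s => [|i s IH].
  by under eq_fun do rewrite big_nil; exact: Qcst.
under eq_fun do rewrite big_cons; case: (P i) => //; exact: QD.
Qed.

Definition fring_poly (p : T -> {poly R}) := forall k, Q (fun x => (p x)`_k).

Lemma fring_polyC f : Q f -> fring_poly (fun x => (f x)%:P).
Proof.
by move=> Qf k; under eq_fun do rewrite coefC; case: eqP => // _; exact: Qcst.
Qed.

Lemma fring_poly_cst p : fring_poly (fun=> p).
Proof. by move=> k; exact: Qcst. Qed.

Lemma fring_polyD p q :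
  fring_poly p -> fring_poly q -> fring_poly (fun x => p x + q x).
Proof. by move=> Qp Qq k; under eq_fun do rewrite coefD; exact: QD. Qed.

Lemma fring_polyM p q :
  fring_poly p -> fring_poly q -> fring_poly (fun x => p x * q x).
Proof.
move=> Qp Qq k; under eq_fun do rewrite coefM.
by apply: fring_sum => i; exact: QM.
Qed.

Lemma fring_poly_det (m : nat) (A : T -> 'M[{poly R}]_m) :
  (forall i j, fring_poly (fun x => A x i j)) -> fring_poly (fun x => \det (A x)).
Proof.
move=> QA; rewrite /determinant; elim: (index_enum _) => [|s e IH].
  by under eq_fun do rewrite big_nil; exact: fring_poly_cst.
under eq_fun do rewrite big_cons; apply: fring_polyD => //.
apply: fring_polyM; first exact: fring_poly_cst.
elim: (index_enum _) => [|i l IHl].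
  by under eq_fun do rewrite big_nil; exact: fring_poly_cst.
by under eq_fun do rewrite big_cons; apply: fring_polyM.
Qed.

Lemma fring_det (m : nat) (A : T -> 'M[R]_m) :
  (forall i j, Q (fun x => A x i j)) -> Q (fun x => \det (A x)).
Proof.
move=> QA.
have /(_ 0%N) : fring_poly (fun x => \det (map_mx polyC (A x))).
  apply: fring_poly_det => i j; under eq_fun do rewrite mxE; exact: fring_polyC.
by under eq_fun do rewrite det_map_mx coefC eqxx.
Qed.

Lemma fring_mulmx (m n p : nat) (A : T -> 'M[R]_(m, n)) (B : T -> 'M[R]_(n, p)) :
  (forall i j, Q (fun x => A x i j)) -> (forall i j, Q (fun x => B x i j)) ->
  forall i j, Q (fun x => (A x *m B x) i j).
Proof.
move=> QA QB i j; under eq_fun do rewrite mxE.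
by apply: fring_sum => k; exact: QM.
Qed.

(** The determinant of X G - P involves no inverse, so its coefficients are polynomial in the
    entries of P and G. It differs from the characteristic polynomial of P G^-1 by the factor
    [\det G]. *)
Lemma fring_char_poly_mulV (m k : nat) (P G : T -> 'M[R]_m) :
  (forall i j, Q (fun x => P x i j)) -> (forall i j, Q (fun x => G x i j)) ->
  Q (fun x => (\det ('X *: map_mx polyC (G x) - map_mx polyC (P x)))`_k).
Proof.
move=> QP QG; apply: fring_poly_det => i j; under eq_fun do rewrite !mxE.
apply: fring_polyD.
  by apply: fring_polyM; [exact: fring_poly_cst|exact: fring_polyC].
under eq_fun do rewrite -polyCN -mulN1r; apply: fring_polyC; exact: QM.
Qed.

End FunctionRing.

Lemma char_poly_mulV (R : realType) (m : nat) (P G : 'M[R]_m) : G \in unitmx ->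
  char_poly (P *m invmx G) =
  (\det G)^-1 *: \det ('X *: map_mx polyC G - map_mx polyC P).
Proof.
move=> Gu.
have -> : 'X *: map_mx polyC G - map_mx polyC P =
    char_poly_mx (P *m invmx G) *m map_mx polyC G.
  rewrite /char_poly_mx mulmxBl mul_scalar_mx -map_mxM; congr (_ - map_mx _ _).
  by rewrite -mulmxA mulVmx// mulmx1.
rewrite det_mulmx det_map_mx -mul_polyC mulrCA -polyCM mulVf ?mulr1//.
by rewrite -unitfE -unitmxE.
Qed.

(** * Charts and differentials *)

Section Calculus.
Variable R : realType.

Lemma smooth_on_differentiable (V W : normedModType R) (U : set V) (f : V -> W)
  (x : V) : smooth_on U f -> U x -> differentiable f x.
Proof. by move=> /(_ 1%N)[+ _]; exact. Qed.

Lemma smooth_on_continuous (V W : normedModType R) (U : set V) (f : V -> W)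
  (x : V) : smooth_on U f -> U x -> {for x, continuous f}.
Proof. by move=> /(_ 0%N); exact. Qed.

Lemma smooth_on_derive (V W : normedModType R) (U : set V) (f : V -> W) (v : V) :
  smooth_on U f -> smooth_on U (fun x => 'D_v f x).
Proof. by move=> fs k; have [_] := fs k.+1; exact. Qed.

Lemma row_jacobian (m n : nat) (f : 'rV[R]_m -> 'rV[R]_n) a i :
  differentiable f a -> row i (jacobian f a) = 'D_(delta_mx 0 i) f a.
Proof. by move=> df; rewrite (deriveEjacobian _ df); exact: rowE. Qed.

Lemma jacobian_eq (m n : nat) (f g : 'rV[R]_m -> 'rV[R]_n) a :
  differentiable f a -> differentiable g a -> (\forall x \near a, f x = g x) ->
  jacobian f a = jacobian g a.
Proof.
move=> df dg fg; apply/row_matrixP => i.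
have fg' := near_eq_derive (delta_mx 0 i) fg.
exact: etrans (row_jacobian i df) (etrans fg' (esym (row_jacobian i dg))).
Qed.

Lemma derive_comp (U V W : normedModType R) (f : U -> V) (g : V -> W) a v :
  differentiable f a -> differentiable g (f a) ->
  'D_v (g \o f) a = 'D_('D_v f a) g (f a).
Proof.
move=> df dg; rewrite !deriveE//; last exact: differentiable_comp.
by rewrite diff_comp.
Qed.

Lemma jacobian_comp (l m n : nat) (f : 'rV[R]_l -> 'rV[R]_m)
    (g : 'rV[R]_m -> 'rV[R]_n) a :
  differentiable f a -> differentiable g (f a) ->
  jacobian (g \o f) a = jacobian f a *m jacobian g (f a).
Proof.
move=> df dg; have dgf : differentiable (g \o f) a by exact: differentiable_comp.
apply/row_matrixP => i; rewrite (row_jacobian _ dgf) row_mul (row_jacobian _ df).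
by rewrite -(deriveEjacobian _ dg); exact: derive_comp.
Qed.

End Calculus.

Section Charts.
Variables (R : realType) (m : nat) (M : manifold R m).

Lemma chart_nbhs (i : chart_index M) (p : M) (P : set M) :
  dom M i p -> (\forall q \near p, P q) ->
  \forall y \near chart M i p, exists q, [/\ dom M i q, P q & y = chart M i q].
Proof.
move=> ip Pp.
have cip : (chart M i @` dom M i) (chart M i p) by exists p.
have Cn := open_nbhs_nbhs (conj (@chart_open _ _ M i) cip).
have Pn : \forall y \near chart M i p, P (chart_inv M i y).
  by apply: (chart_inv_continuous cip); rewrite chartK.
near=> y.
have [q iq qy] : (chart M i @` dom M i) y by near: y.
exists q; split=> //; rewrite -(chartK iq) qy.
by near: y.
Unshelve. all: by end_near. Qed.

Lemma dom_nbhs (i : chart_index M) (p : M) : dom M i p -> \forall q \near p, dom M i q.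
Proof. by move=> ip; apply: open_nbhs_nbhs; split=> //; exact: dom_open. Qed.

Lemma chart_at_dom (p : M) : dom M (chart_at p) p.
Proof. exact: projT2 (cid (dom_cover p)). Qed.

Lemma transition_differentiable (i j : chart_index M) (p : M) :
  dom M i p -> dom M j p ->
  differentiable (chart M j \o chart_inv M i) (chart M i p).
Proof.
by move=> ip jp; apply: smooth_on_differentiable (@transition_smooth _ _ M i j) _; exists p.
Qed.

End Charts.

Section Maps.
Variables (R : realType) (m n : nat) (M : manifold R m) (N : manifold R n).
Variables (f : M -> N) (fs : smooth f).

Lemma local_repr_differentiable i j p : dom M i p -> dom N j (f p) ->
  differentiable (local_repr f i j) (chart M i p).
Proof.
by move=> ip jp; have [_ /(_ i j)/smooth_on_differentiable] := fs; apply; exists p.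
Qed.

Lemma differential_change i i' j j' p : dom M i p -> dom M i' p ->
  dom N j (f p) -> dom N j' (f p) ->
  differential f i j p =
  jacobian (chart M i' \o chart_inv M i) (chart M i p) *m differential f i' j' p
  *m jacobian (chart N j \o chart_inv N j') (chart N j' (f p)).
Proof.
move=> ip i'p jp j'p; rewrite /differential.
set t := chart M i' \o chart_inv M i.
set s := chart N j \o chart_inv N j'.
have tp : t (chart M i p) = chart M i' p by rewrite /t/= chartK.
have rp : local_repr f i' j' (chart M i' p) = chart N j' (f p).
  by rewrite /local_repr/= chartK.
have dt : differentiable t (chart M i p) by exact: transition_differentiable.
have dr := local_repr_differentiable i'p j'p.
have ds : differentiable s (chart N j' (f p)) by exact: transition_differentiable.
have dc : differentiable (local_repr f i' j' \o t) (chart M i p).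
  by apply: differentiable_comp => //; rewrite tp.
have E1 : jacobian (local_repr f i' j' \o t) (chart M i p) =
    jacobian t (chart M i p) *m jacobian (local_repr f i' j') (chart M i' p).
  by rewrite -tp; apply: jacobian_comp; rewrite ?tp.
have tr : (local_repr f i' j' \o t) (chart M i p) = chart N j' (f p) by rewrite /= tp rp.
have E2 : jacobian (s \o (local_repr f i' j' \o t)) (chart M i p) =
    jacobian (local_repr f i' j' \o t) (chart M i p) *m jacobian s (chart N j' (f p)).
  by rewrite -tr; apply: jacobian_comp; rewrite ?tr.
apply: etrans (etrans E2 (congr1 (mulmx^~ _) E1)).
apply: jacobian_eq.
- exact: local_repr_differentiable.
- by apply: differentiable_comp => //=; rewrite tp rp.
(* Jacobians depend on germs: the two local expressions agree wherever the charts [i'] and [j'] also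
   apply, which by continuity of [f] holds near p. *)
have [fc _] := fs.
have near_j' : \forall q \near p, dom M i' q /\ dom N j' (f q).
  apply: filterI; first exact: dom_nbhs.
  exact: (fc p _ (dom_nbhs j'p)).
have := chart_nbhs ip near_j'; apply: filterS => _ [q [iq [i'q j'q] ->]].
by rewrite /s/t/local_repr/= !chartK.
Qed.

(** In [pullback] the chart of N is selected at each f p and may jump with p; a fixed j gives
    entries that vary continuously. *)
Definition pullback_in (h : metric N) i j p : 'M[R]_m :=
  differential f i j p *m h j (f p) *m (differential f i j p)^T.

Lemma metric_unitmx (g : metric M) i p : dom M i p -> g i p \in unitmx.
Proof.
move=> ip; rewrite -row_free_unit -kermx_eq0; apply/rowV0P => v /sub_kermxP vG.
by apply/eqP/negP => /negP /(metric_pos g ip); rewrite vG mul0mx mxE ltxx.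
Qed.

End Maps.

Section Densities.
Variables (R : realType) (m n : nat) (M : manifold R m) (N : manifold R n).
Variables (g : metric M) (h : metric N).

Lemma pullback_in_change (f : M -> N) i i' j j' p : smooth f ->
  dom M i p -> dom M i' p -> dom N j (f p) -> dom N j' (f p) ->
  let T := jacobian (chart M i' \o chart_inv M i) (chart M i p) in
  pullback_in f h i j p = T *m pullback_in f h i' j' p *m T^T.
Proof.
move=> fs ip i'p jp j'p T; rewrite /pullback_in.
rewrite (differential_change fs ip i'p jp j'p) -/T.
by rewrite (metric_compat h j'p jp) !trmx_mul !mulmxA.
Qed.

(** Invertibility is read off from g = T g' T^T, whose left side is invertible. *)
Lemma transition_unitmx i i' p : dom M i p -> dom M i' p ->
  jacobian (chart M i' \o chart_inv M i) (chart M i p) \in unitmx.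
Proof.
move=> ip i'p; have := metric_unitmx g ip.
by rewrite (metric_compat g ip i'p) unitmx_mul => /andP[]; rewrite unitmx_mul => /andP[].
Qed.

(** Both f^*h and g change by congruence with T, so f^*h g^-1 changes by conjugation with T.
    Invariants of [alpha] can thus be computed in any charts around p and f p. *)
Lemma char_poly_alpha (f : M -> N) i j p : smooth f -> dom M i p -> dom N j (f p) ->
  char_poly (alpha g h f p) = char_poly (pullback_in f h i j p *m invmx (g i p)).
Proof.
move=> fs ip jp; have ap := chart_at_dom p; have afp := chart_at_dom (f p).
rewrite /alpha; set i' := chart_at p in ap *.
rewrite -[pullback h f i' p]/(pullback_in f h i' (chart_at (f p)) p).
rewrite (pullback_in_change fs ap ip afp jp).
have Tu := transition_unitmx ap ip.
have gc := metric_compat g ap ip.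
set T := jacobian _ _ in Tu gc *; set P := pullback_in f h i j p.
apply: (char_poly_intertwine Tu).
have Tg : T *m g i p = g i' p *m invmx T^T.
  by rewrite gc mulmxK// unitmx_tr.
have -> : T *m P *m T^T *m invmx (g i' p) *m T =
    T *m P *m T^T *m invmx (g i' p) *m (T *m g i p) *m invmx (g i p).
  by rewrite mulmxA mulmxK// metric_unitmx.
by rewrite Tg !mulmxA mulmxKV ?metric_unitmx// mulmxK ?unitmx_tr.
Qed.

Lemma pullback_in_sym (f : M -> N) i j p : dom N j (f p) ->
  (pullback_in f h i j p)^T = pullback_in f h i j p.
Proof. by move=> jp; rewrite /pullback_in !trmx_mul trmxK Defs.metric_sym// mulmxA. Qed.

Lemma pullback_in_ge0 (f : M -> N) i j p (v : 'rV[R]_m) : dom N j (f p) ->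
  0 <= (v *m pullback_in f h i j p *m v^T) 0 0.
Proof.
move=> jp; rewrite /pullback_in; set D := differential _ _ _ _.
have -> : v *m (D *m h j (f p) *m D^T) *m v^T = (v *m D) *m h j (f p) *m (v *m D)^T.
  by rewrite trmx_mul !mulmxA.
have [->|v0] := eqVneq (v *m D) 0; first by rewrite !mul0mx mxE.
by rewrite ltW// metric_pos.
Qed.

Lemma nonneg_spectrum_alpha (f : M -> N) p : nonneg_spectrum (alpha g h f p).
Proof.
have ap := chart_at_dom p; have afp := chart_at_dom (f p).
have [] := @char_poly_split R m (g (chart_at p) p)
  (pullback_in f h (chart_at p) (chart_at (f p)) p) (Defs.metric_sym g ap)
  (metric_pos g ap) (pullback_in_sym _ afp) (fun v => pullback_in_ge0 _ v afp).
by [].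
Qed.

Lemma epsilonE r (f : M -> N) i j p : (r <= m)%N ->
  smooth f -> dom M i p -> dom N j (f p) ->
  epsilon r g h f p = (-1) ^+ r * ((\det (g i p))^-1 *
    (\det ('X *: map_mx polyC (g i p) -
           map_mx polyC (pullback_in f h i j p)))`_(m - r)).
Proof.
move=> rm fs ip jp.
rewrite /epsilon elementary_symmetric_eigenvalues//; last exact: nonneg_spectrum_alpha.
by rewrite (char_poly_alpha fs ip jp) char_poly_mulV ?metric_unitmx// coefZ.
Qed.

Lemma volume_densityE (f : M -> N) i j p : smooth f -> dom M i p -> dom N j (f p) ->
  volume_density g h f p =
  Num.sqrt (\det (pullback_in f h i j p) * (\det (g i p))^-1).
Proof.
move=> fs ip jp; rewrite /volume_density; congr Num.sqrt.
by rewrite (char_poly_det_eq (char_poly_alpha fs ip jp)) det_mulmx det_inv.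
Qed.

End Densities.

(** * Pointwise comparison of the energy and volume densities *)

Section PointwiseInequality.
Variables (R : realType) (r n : nat).
Variables (M : manifold R (2 * r)) (N : manifold R n) (g : metric M) (h : metric N).

Lemma epsilon_ge_volume_density (f : M -> N) p :
  'C(2 * r, r)%:R * volume_density g h f p <= epsilon r g h f p.
Proof. exact/elementary_symmetric_ge_sqrt_det/nonneg_spectrum_alpha. Qed.

Lemma epsilon_conformal (f : M -> N) p c : 0 <= c ->
  pullback h f (chart_at p) p = c *: g (chart_at p) p ->
  epsilon r g h f p = 'C(2 * r, r)%:R * volume_density g h f p.
Proof.
move=> c0 fc; rewrite /epsilon /volume_density.
have -> : alpha g h f p = c%:M.
  rewrite /alpha fc -scalemxAl mulmxV ?scale_mx1 ?scalemx1//.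
  exact/metric_unitmx/chart_at_dom.
exact: elementary_symmetric_scalar.
Qed.

(** Both sides vanish: with rank below r, the factor X^(2r - rank) of the characteristic polynomial
    of [alpha] has degree above r, so the coefficients of degree r and 0 are zero. *)
Lemma epsilon_rank (f : M -> N) p :
  (\rank (differential f (chart_at p) (chart_at (f p)) p) < r)%N ->
  epsilon r g h f p = 'C(2 * r, r)%:R * volume_density g h f p.
Proof.
move=> rk; have r2 : (r <= 2 * r)%N by rewrite leq_pmull.
have ark : (\rank (alpha g h f p) < r)%N.
  apply: leq_ltn_trans rk.
  by rewrite /alpha /pullback -!mulmxA; exact: mxrankM_maxl.
have sp := nonneg_spectrum_alpha g h f p.
rewrite /epsilon elementary_symmetric_eigenvalues// char_poly_coef_rank; last first.
  by rewrite -ltn_subRL subKn.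
rewrite mulr0 /volume_density.
suff -> : \det (alpha g h f p) = 0 by rewrite sqrtr0 mulr0.
apply: (mulfI (_ : (-1) ^+ (2 * r) != 0)); first by rewrite signr_eq0.
rewrite -char_poly_det char_poly_coef_rank ?mulr0// add0n.
exact: leq_trans ark r2.
Qed.

End PointwiseInequality.

(** * Riemannian measures *)

Section LowerIntegral.
Local Open Scope ereal_scope.

(** Since 0 lies in both sets, a finite bound on the sums bounds each set separately, and all
    subtractions take place between finite numbers. *)
Lemma ge0_ereal_supD (R : realType) (A B : set (\bar R)) (c : \bar R) :
  A 0 -> B 0 -> (forall a, A a -> 0 <= a) -> (forall b, B b -> 0 <= b) ->
  (forall a b, A a -> B b -> a + b <= c) -> ereal_sup A + ereal_sup B <= c.
Proof.
move=> A0 B0 Age0 Bge0 ABc.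
have c0 : 0 <= c by have := ABc _ _ A0 B0; rewrite adde0.
case: c c0 ABc => [r r0 ABc|_ _|//]; last exact: leey.
have sB a : A a -> ereal_sup B <= r%:E - a.
  move=> Aa; apply: ge_ereal_sup => b Bb.
  have afin : a \is a fin_num.
    rewrite ge0_fin_numE ?Age0// (@le_lt_trans _ _ r%:E) ?ltry//.
    by have := ABc _ _ Aa B0; rewrite adde0.
  by rewrite leeBrDr// addeC; exact: ABc.
have B0' : 0 <= ereal_sup B by exact: ereal_sup_ubound.
have Bfin : ereal_sup B \is a fin_num.
  by rewrite ge0_fin_numE// (@le_lt_trans _ _ r%:E) ?ltry// (le_trans (sB _ A0))// sube0.
rewrite -leeBrDr//; apply: ge_ereal_sup => a Aa.
have afin : a \is a fin_num.
  rewrite ge0_fin_numE ?Age0// (@le_lt_trans _ _ r%:E) ?ltry//.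
  by have := ABc _ _ Aa B0; rewrite adde0.
by rewrite leeBrDr// addeC -leeBrDr// sB.
Qed.

Context d (T : measurableType d) (R : realType).
Variable mu : {measure set T -> \bar R}.
Implicit Types f g : T -> \bar R.
Import HBNNSimple.

Lemma ge0_le_lower_integral f g : (forall x, 0 <= f x) ->
  (forall x, f x <= g x) -> \int[mu]_x f x <= \int[mu]_x g x.
Proof.
move=> f0 fg; have g0 x : 0 <= g x by exact: le_trans (fg x).
rewrite !ge0_integralTE//; apply: le_ereal_sup => _ [u /= uf <-].
by exists u => //= x; exact: le_trans (fg x).
Qed.

Lemma ge0_lower_integralD f g : (forall x, 0 <= f x) -> (forall x, 0 <= g x) ->
  \int[mu]_x f x + \int[mu]_x g x <= \int[mu]_x (f x + g x).
Proof.
move=> f0 g0; rewrite !ge0_integralTE//; last by move=> x; rewrite adde_ge0.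
apply: ge0_ereal_supD.
- by exists nnsfun0 => //; exact: sintegral0.
- by exists nnsfun0 => //; exact: sintegral0.
- by move=> _ [u _ <-]; exact: sintegral_ge0.
- by move=> _ [u _ <-]; exact: sintegral_ge0.
move=> _ _ [u /= uf <-] [v /= vg <-]; apply: ereal_sup_ubound.
exists (add_nnsfun u v) => /=.
  by move=> x; rewrite EFinD leeD.
by rewrite -sintegralD.
Qed.

Lemma ge0_lower_integralZl f k : (0 <= k)%R -> (forall x, 0 <= f x) ->
  \int[mu]_x (k%:E * f x) = k%:E * \int[mu]_x f x.
Proof.
(* One inequality for all positive factors is enough: the reverse one is its instance for k^-1 and
   the function k f. *)
have le j g : (0 < j)%R -> (forall x, 0 <= g x) ->
    j%:E * \int[mu]_x g x <= \int[mu]_x (j%:E * g x).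
  move=> j0 g0; rewrite !ge0_integralTE//; last first.
    by move=> x; rewrite mule_ge0// lee_fin ltW.
  rewrite muleC -lee_pdivlMr//; apply: ge_ereal_sup => _ [u /= ug <-].
  rewrite lee_pdivlMr// muleC; apply: ereal_sup_ubound.
  exists (scale_nnsfun u (ltW j0)) => /=; last by rewrite -sintegralrM.
  by move=> x; rewrite EFinM lee_pmul2l.
rewrite le_eqVlt => /predU1P[<- f0|k0 f0].
  by rewrite mul0e; under eq_integral do rewrite mul0e; exact: integral0.
apply/eqP; rewrite eq_le le// andbT muleC -lee_pdivrMr//.
have kf0 x : 0 <= k%:E * f x by rewrite mule_ge0// lee_fin ltW.
apply: le_trans (_ : _ <= \int[mu]_x (k^-1%:E * (k%:E * f x))) _.
  by rewrite muleC; apply: le; rewrite ?invr_gt0.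
under eq_integral do rewrite muleA -EFinM mulVf ?gt_eqF// mul1e.
by [].
Qed.

End LowerIntegral.

(* The integral of an arbitrary nonnegative function is a supremum over simple
   functions, hence monotone, superadditive and positively homogeneous: these
   properties replace Tonelli's theorem, and no measurability is required. *)
Section IteratedIntegral.
Variable R : realType.
Local Open Scope ereal_scope.

Lemma integral_rV_ge0 m (f : 'rV[R]_m -> \bar R) : (forall y, 0 <= f y) ->
  0 <= integral_rV f.
Proof. by elim: m f => [|m IH] f f0 //=; apply: integral_ge0 => x _; exact: IH. Qed.

Lemma le_integral_rV m (f g : 'rV[R]_m -> \bar R) : (forall y, 0 <= f y) ->
  (forall y, f y <= g y) -> integral_rV f <= integral_rV g.
Proof.
elim: m f g => [|m IH] f g f0 fg //=.
apply: ge0_le_lower_integral => x; last exact: IH.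
exact: integral_rV_ge0.
Qed.

Lemma integral_rV_superadditive m (f g : 'rV[R]_m -> \bar R) :
  (forall y, 0 <= f y) -> (forall y, 0 <= g y) ->
  integral_rV f + integral_rV g <= integral_rV (fun y => f y + g y).
Proof.
elim: m f g => [|m IH] f g f0 g0 //=.
apply: le_trans (ge0_lower_integralD _ _ _) _; try by move=> x; exact: integral_rV_ge0.
apply: ge0_le_lower_integral => x; last exact: IH.
by rewrite adde_ge0//; exact: integral_rV_ge0.
Qed.

Lemma integral_rVZl m (f : 'rV[R]_m -> \bar R) k : (0 <= k)%R ->
  (forall y, 0 <= f y) -> integral_rV (fun y => k%:E * f y) = k%:E * integral_rV f.
Proof.
move=> k0; elim: m f => [|m IH] f f0 //=.
rewrite -ge0_lower_integralZl//; last by move=> x; exact: integral_rV_ge0.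
by apply: eq_integral => x _; rewrite IH.
Qed.

Lemma integral_rV_superadditive_sum m (I : Type) (s : seq I)
    (f : I -> 'rV[R]_m -> \bar R) : (forall i y, 0 <= f i y) ->
  \sum_(i <- s) integral_rV (f i) <= integral_rV (fun y => \sum_(i <- s) f i y).
Proof.
move=> f0; elim: s => [|i s IH].
  by rewrite big_nil; apply: integral_rV_ge0 => y; rewrite big_nil.
rewrite big_cons.
have -> : (fun y => \sum_(j <- i :: s) f j y) = (fun y => f i y + \sum_(j <- s) f j y).
  by apply/funext => y; rewrite big_cons.
apply: le_trans (integral_rV_superadditive _ _) => //.
  exact: leeD.
by move=> y; apply: sume_ge0.
Qed.

(** The support lies in a cube with centre a and half-side b, and each of the m successive
    integrations contributes a factor 2b. This is the source of local finiteness of Riemannian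
    measures. *)
Lemma integral_rV_box m (f : 'rV[R]_m -> \bar R) (a : 'rV[R]_m) (b k : R) :
  (0 <= k)%R -> (0 <= b)%R ->
  (forall y, 0 <= f y <= k%:E) ->
  (forall (y : 'rV[R]_m) j, (b < `|y ord0 j - a ord0 j|)%R -> f y = 0) ->
  integral_rV f <= (k * (2 * b) ^+ m)%:E.
Proof.
move=> k0 b0; elim: m f a => [|m IH] f a fk f0 /=.
  by rewrite expr0 mulr1; case/andP: (fk 0%R).
pose x0 : R := a ord0 ord0.
pose I : set R := `[(x0 - b)%R, (x0 + b)%R]%classic.
set K := (k * (2 * b) ^+ m)%R.
have K0 : (0 <= K)%R by rewrite mulr_ge0// exprn_ge0// mulr_ge0.
apply: (@le_trans _ _ (\int[lebesgue_measure]_x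
    (K%:E * (\1_I x)%:E))).
  apply: ge0_le_lower_integral => x.
    by apply: integral_rV_ge0 => y; case/andP: (fk (row_mx x%:M y : 'rV_(1 + m))).
  have [xb|] := boolP (x \in I).
    rewrite indicE xb mule1.
    apply: (IH _ (\row_j a ord0 (rshift 1 j))) => [y|y j]; first exact: fk.
    move=> yj; apply: (f0 _ (rshift 1 j)).
    by move: yj; rewrite [X in (_ - X)%R]mxE -(row_mxEr (x%:M : 'M[R]_1) y ord0 j).
  rewrite indicE => xb; rewrite (negbTE xb) mule0.
  (* The slice is zero; writing it as 0 times 0 lets homogeneity evaluate its iterated integral. *)
  have -> : (fun y => f (row_mx (x%:M : 'M[R]_1) y : 'rV[R]_(1 + m))) = (fun y => 0%:E * 0).
    apply/funext => y; rewrite mule0.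
    have xE : (row_mx (x%:M : 'M[R]_1) y ord0 (lshift m (ord0 : 'I_1)) = x).
      by rewrite row_mxEl mxE eqxx mulr1n.
    apply: (f0 _ (lshift m (ord0 : 'I_1))); rewrite [X in (X - _)%R]xE.
    move: xb; rewrite /I mem_setE in_itv/= -ler_distl -ltNge /x0.
    by congr (_ < `| _ - _ |)%R; congr (a _ _); apply/val_inj.
  by rewrite integral_rVZl// mul0e.
rewrite ge0_lower_integralZl//.
rewrite integral_indic ?setIT//; last exact: measurable_itv.
have mI : lebesgue_measure I = (2 * b)%:E.
  rewrite /I lebesgue_measure_itv/= lte_fin; case: ltP => [_|].
    by rewrite -EFinD; congr _%:E; rewrite opprB addrC addrA subrK mulr2n mulrDl mul1r.
  rewrite lerBrDr => h; have -> : b = 0%R; last by rewrite mulr0.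
  apply/eqP; rewrite eq_le b0 andbT; move: h; rewrite -addrA gerDl -mulr2n.
  by rewrite pmulrn_lle0.
apply: (@le_trans _ _ (K%:E * (2 * b)%:E)); first by rewrite -mI.
by rewrite -EFinM lee_fin exprSr /K mulrA.
Qed.

End IteratedIntegral.

(** * Measures given by a density *)

Section Density.
Local Open Scope ereal_scope.
Context d (T : measurableType d) (R : realType).
Variables (mu : {measure set T -> \bar R}) (w : T -> R).
Hypotheses (w0 : forall x, (0 <= w x)%R) (mw : measurable_fun setT w).

(** The two proofs are arguments so that the term itself determines its measure structure. *)
Definition density_measure (_ : forall x, (0 <= w x)%R)
  (_ : measurable_fun setT w) (A : set T) := \int[mu]_(x in A) (w x)%:E.

Let nu := density_measure w0 mw.

Let nu0 : nu set0 = 0.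
Proof. exact: integral_set0. Qed.

Let nu_ge0 A : 0 <= nu A.
Proof. by apply: integral_ge0 => x _; rewrite lee_fin. Qed.

Let nu_sigma_additive : semi_sigma_additive nu.
Proof.
move=> F mF tF mUF.
rewrite /nu /density_measure ge0_integral_bigcup//; last by move=> x _; rewrite lee_fin.
  apply: is_cvg_ereal_nneg_natsum_cond => n _ _; exact: nu_ge0.
exact/measurable_EFinP/measurable_funTS.
Qed.

HB.instance Definition _ := isMeasure.Build _ _ _ nu nu0 nu_ge0 nu_sigma_additive.

Definition density : {measure set T -> \bar R} := nu.

Import HBNNSimple.

Let integral_density_nnsfun (u : {nnsfun T >-> R}) :
  \int[density]_x (u x)%:E = \int[mu]_x (u x * w x)%:E.
Proof.
rewrite integralT_nnsfun sintegralE.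
pose f k x := k%:E * (\1_(u @^-1` [set k]) x)%:E * (w x)%:E.
have f0 k x : 0 <= f k x.
  by rewrite mule_ge0 ?lee_fin//; exact: nnfun_muleindic_ge0.
have mA k : measurable (u @^-1` [set k]) by exact: measurable_sfunP.
have mwE : measurable_fun setT (EFin \o w) by exact/measurable_EFinP.
transitivity (\int[mu]_x (\sum_(k \in range u) f k x)); last first.
  apply: eq_integral => x _; rewrite {1}(fimfunE u x) EFinM -fsumEFin//.
  rewrite ge0_mule_fsuml//; last by move=> k; exact: nnfun_muleindic_ge0.
rewrite ge0_integral_fsum//.
  apply: eq_fsbigr => k; rewrite inE => -[y _ uy].
  have k0 : (0 <= k)%R by rewrite -uy.
  rewrite [density _]integral_mkcond -ge0_integralZl_EFin//; last 2 first.
    by move=> x _; apply: erestrict_ge0 => z _; rewrite lee_fin.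
    exact/(measurable_restrictT _ (mA k)).1/measurable_funTS.
  apply: eq_integral => x _; rewrite /f -muleA patchE indicE.
  by case: (x \in _); rewrite ?mul1e ?mul0e.
move=> k; apply: emeasurable_funM => //; apply/measurable_EFinP.
by apply: measurable_funM => //; exact: measurable_indic.
Qed.

Lemma integral_density (f : T -> R) : (forall x, (0 <= f x)%R) ->
  measurable_fun setT f ->
  \int[density]_x (f x)%:E = \int[mu]_x (f x * w x)%:E.
Proof.
move=> f0 mf.
have mfE : measurable_fun setT (EFin \o f) by exact/measurable_EFinP.
pose F n := nnsfun_approx measurableT mfE n.
have cF x : (F n x)%:E @[n --> \oo] --> (f x)%:E.
  by apply: cvg_nnsfun_approx => // y _; rewrite lee_fin.
have ndF x : nondecreasing_seq (fun n => F n x).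
  by move=> a b ab; exact/lefP/nd_nnsfun_approx.
transitivity (limn (fun n => \int[density]_x (F n x)%:E)).
  rewrite -monotone_convergence//.
  - by apply: eq_integral => x _; apply/esym/cvg_lim => //; exact: cF.
  - by move=> n; exact/measurable_EFinP.
  - by move=> n x _; rewrite lee_fin.
  - by move=> x _ a b ab; rewrite lee_fin ndF.
under eq_fun do rewrite integral_density_nnsfun.
rewrite -monotone_convergence//.
- apply: eq_integral => x _; apply/cvg_lim => //.
  rewrite EFinM; under eq_fun do rewrite EFinM.
  by apply: cvgeZr => //; exact: cF.
- by move=> n; apply/measurable_EFinP; exact: measurable_funM.
- by move=> n x _; rewrite lee_fin mulr_ge0.
- by move=> x _ a b ab; rewrite lee_fin ler_wpM2r// ndF.
Qed.

End Density.

(** * Borel sets of a compact space *)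

Section Compactness.
Variables (X : ptopologicalType).

Lemma open_borel (A : set (borel X)) : @open X A -> measurable A.
Proof. by move=> oA; exact: sub_sigma_algebra. Qed.

(** Localisation principle for finiteness and uniqueness of measures: a finite cover by the given
    open sets is removed from A one member at a time, each step splitting A into [A]&[B] and
    [A]\[B]. *)
Lemma compact_measurable_ind (P : set (borel X) -> Prop) :
  compact [set: X] -> P set0 ->
  (forall A B, measurable A -> measurable B ->
     P (A `&` B) -> P (A `\` B) -> P A) ->
  (forall p : X, exists V : set X, [/\ open V, V p &
     forall A : set (borel X), measurable A -> A `<=` V -> P A]) ->
  forall A, measurable A -> P A.
Proof.
move=> cX P0 PD Ploc.
pose V p := projT1 (cid (Ploc p)).
have VP p : [/\ open (V p), V p p & forall A : set (borel X), measurable A -> A `<=` V p -> P A].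
  exact: projT2 (cid (Ploc p)).
have : finite_subset_cover [set: X] V [set: X].
  move: cX; rewrite compact_cover; apply => [p _|p _]; first by have [] := VP p.
  by exists p => //; have [] := VP p.
move=> [D _ DV].
suff key (s : seq X) (A : set (borel X)) : measurable A ->
    A `<=` [set x | exists2 p, p \in s & V p x] -> P A.
  move=> A mA; apply: (key (finmap.enum_fset D)) => // x _.
  by have [p pD px] := DV x Logic.I; exists p.
elim: s A => [|p s IH] A mA As.
  by rewrite (_ : A = set0)// -subset0 => x /As[].
have [oV _ PV] := VP p.
apply: (PD A (V p)) => //; first exact: open_borel.
  apply: PV; last exact: subIsetr.
  by apply: measurableI => //; exact: open_borel.
apply: IH => [|x [/As[q]]].
  by apply: measurableD => //; exact: open_borel.
by rewrite inE => /predU1P[->//|qs Vx _]; exists q.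
Qed.

Lemma continuous_measurable_borel (R : realType) (f : X -> R) :
  continuous f -> measurable_fun [set: borel X] f.
Proof.
move=> /continuousP cf; apply: (measurability _ (RGenOpens.measurableE R)).
move=> _ [_ [a [b ->] <-]]; rewrite setTI; apply: open_borel.
exact/cf/interval_open.
Qed.

End Compactness.

Section Continuity.

Lemma near_eq_continuous (T U : topologicalType) (f g : T -> U) x :
  (\forall y \near x, f y = g y) -> {for x, continuous f} -> {for x, continuous g}.
Proof.
move=> fg cf; have fgx : f x = g x by exact: nbhs_singleton fg.
change (g @ x --> g x); rewrite -fgx; apply: cvg_trans cf.
by apply: near_eq_cvg; apply: filterS fg => y.
Qed.

Variables (R : realType) (T : topologicalType) (x : T).
Let Q (f : T -> R) := {for x, continuous f}.

Lemma fring_continuous_cst c : Q (fun=> c). Proof. exact: cst_continuous. Qed.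

Lemma fring_continuousD f g : Q f -> Q g -> Q (fun y => f y + g y).
Proof. exact: continuousD. Qed.

Lemma fring_continuousM f g : Q f -> Q g -> Q (fun y => f y * g y).
Proof. exact: continuousM. Qed.

Lemma continuous_for_comp (U V : topologicalType) (f : T -> U) (g : U -> V) :
  {for x, continuous f} -> {for f x, continuous g} ->
  {for x, continuous (fun y => g (f y))}.
Proof. exact: continuous_comp. Qed.

End Continuity.

Section RiemannianMeasure.
Variables (R : realType) (m : nat) (M : manifold R m).
Implicit Types g : metric M.

Lemma metric_continuous g i p a b : dom M i p ->
  {for p, continuous (fun q => g i q a b)}.
Proof.
move=> ip.
apply: (@near_eq_continuous _ _ (fun q => (g i \o chart_inv M i) (chart M i q) a b)).
  by apply: filterS (dom_nbhs ip) => q iq; rewrite /= chartK.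
apply: (@continuous_for_comp _ _ _ _ (fun q => (g i \o chart_inv M i) (chart M i q))
  (fun A : 'M[R]_m => A a b)); last exact: coord_continuous.
apply: continuous_for_comp; first exact: chart_continuous.
by apply: smooth_on_continuous (metric_smooth g i) _; exists p.
Qed.

Lemma metric_det_continuous g i p : dom M i p ->
  {for p, continuous (fun q => \det (g i q))}.
Proof.
move=> ip; apply: (fring_det (Q := fun f : M -> R => {for p, continuous f})).
- exact: fring_continuous_cst.
- exact: fring_continuousD.
- exact: fring_continuousM.
- by move=> a b; exact: metric_continuous.
Qed.

Definition chart_integral g i (A : set M) (f : M -> R) : \bar R :=
  integral_rV (fun y : 'rV[R]_m =>
    (\1_(chart M i @` A) y *
     (f (chart_inv M i y) * Num.sqrt (\det (g i (chart_inv M i y)))))%:E).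

Lemma riemannian_measureE g mu i (A : set (borel M)) : is_riemannian_measure g mu ->
  measurable A -> A `<=` dom M i -> mu A = chart_integral g i A (fun=> 1).
Proof.
move=> gmu mA Ai; rewrite (gmu i)// /chart_integral; congr integral_rV.
by apply/funext => y; rewrite mul1r.
Qed.

(** Near each point the chart stays in a cube of half-side 1 and the density, being continuous,
    stays below its value plus 1. The cube bound then applies locally, and compactness globalises
    it. *)
Lemma riemannian_measure_fin g mu : compact [set: M] ->
  is_riemannian_measure g mu -> forall A, measurable A -> (mu A < +oo)%E.
Proof.
move=> cM gmu.
apply: (compact_measurable_ind (P := fun A => mu A < +oo)%E) => //.
- by rewrite measure0.
- move=> A B mA mB AB1 AB2; rewrite (measureDI mu mA mB).
  by rewrite lte_add_pinfty.
move=> p; have ip := chart_at_dom p; set i := chart_at p in ip.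
pose w q := Num.sqrt (\det (g i q)).
have cw : {for p, continuous w}.
  by apply: continuous_for_comp; [exact: metric_det_continuous|exact: sqrt_continuous].
pose k := w p + 1.
have near_k : \forall q \near p, w q <= k.
  have /cvgrPdist_lt/(_ 1 ltr01) := cw; apply: filterS => q.
  by rewrite distrC => /ltr_distlDr/ltW.
have near_b : \forall q \near p, `|chart M i p - chart M i q| < 1.
  have /cvgrPdist_lt/(_ 1 ltr01) := @chart_continuous _ _ M i p ip.
  exact.
have /filterI/(_ near_b)/filterI/(_ near_k) := dom_nbhs ip.
rewrite nbhsE => -[V [oV Vp] VP]; exists V; split=> // A mA AV.
have Ai : A `<=` dom M i by move=> q /AV/VP[[]].
rewrite (riemannian_measureE gmu mA Ai).
have k0 : 0 <= k by rewrite addr_ge0// sqrtr_ge0.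
apply: (le_lt_trans (integral_rV_box (a := chart M i p) (b := 1) k0 ler01 _ _)).
- move=> y; rewrite mul1r.
  have [[q Aq <-]|nA] := pselect ((chart M i @` A) y).
    rewrite indicE mem_set/=; last by exists q.
    rewrite mul1r chartK; last exact: Ai.
    by rewrite !lee_fin sqrtr_ge0/=; have [_] := VP _ (AV _ Aq).
  by rewrite indicE memNset// mul0r !lee_fin lexx.
- move=> y j yj; rewrite indicE memNset ?mul0r// => -[q Aq qy].
  have [[_ bq] _] := VP _ (AV _ Aq).
  move: yj; rewrite ltNge => /negP; apply.
  apply: le_trans (ltW bq); rewrite -qy distrC.
  rewrite [leRHS]/Num.Def.normr/= mx_normrE.
  by apply: le_trans; last exact: (le_bigmax _ _ (ord0, j)); rewrite !mxE.
exact: ltry.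
Qed.

Lemma riemannian_measure_unique g mu1 mu2 : compact [set: M] ->
  is_riemannian_measure g mu1 -> is_riemannian_measure g mu2 ->
  forall A, measurable A -> mu1 A = mu2 A.
Proof.
move=> cM g1 g2; apply: (compact_measurable_ind (P := fun A => mu1 A = mu2 A)) => //.
- by rewrite !measure0.
- by move=> A B mA mB AB1 AB2; rewrite (measureDI mu1 mA mB) (measureDI mu2 mA mB); congr adde.
move=> p; exists (dom M (chart_at p)); split; [exact: dom_open|exact: chart_at_dom|].
by move=> A mA Ai; rewrite (g1 (chart_at p))// (g2 (chart_at p)).
Qed.

End RiemannianMeasure.

(** * Integration against a Riemannian measure in a chart *)

Section ConformalMeasure.
Variables (R : realType) (m : nat) (M : manifold R m).
Implicit Types g : metric M.
Local Open Scope ereal_scope.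
Import HBNNSimple.

Lemma chart_inj i p q : dom M i p -> dom M i q -> chart M i p = chart M i q -> p = q.
Proof. by move=> ip iq pq; rewrite -(chartK ip) pq chartK. Qed.

(** A simple function below f is cut into its level sets, whose measures are chart integrals;
    superadditivity reassembles the pieces under f. Superadditivity works in one direction, hence an
    inequality. *)
Lemma integral_le_chart_integral g mu i (A : set (borel M)) (f : M -> R) :
  is_riemannian_measure g mu -> measurable A -> A `<=` dom M i ->
  (forall p, (0 <= f p)%R) ->
  \int[mu]_(x in A) (f x)%:E <= chart_integral g i A f.
Proof.
move=> gmu mA Ai f0; rewrite ge0_integralE; last by move=> p _; rewrite lee_fin.
apply: ge_ereal_sup => _ [u /= uf <-].
have uA p : ~ A p -> u p = 0%R.
  move=> nA; have := uf p; rewrite patchE memNset// lee_fin => u0.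
  by apply/eqP; rewrite eq_le u0/= fun_ge0.
have uf' p : A p -> (u p <= f p)%R.
  by move=> Ap; have := uf p; rewrite patchE mem_set.
pose W (y : 'rV[R]_m) := Num.sqrt (\det (g i (chart_inv M i y))).
(* The absolute value makes [F k] nonnegative for every real k; the values actually taken by [u] are
   nonnegative. *)
pose F (k : R) (y : 'rV[R]_m) : \bar R :=
  (`|k| * (\1_(chart M i @` (A `&` u @^-1` [set k])) y * W y))%:E.
have F0 k y : 0 <= F k y.
  by rewrite lee_fin !mulr_ge0// ?sqrtr_ge0// indicE.
rewrite sintegralE fsbig_finite//.
apply: (@le_trans _ _ (\sum_(k <- finmap.enum_fset (fset_set (range u))) integral_rV (F k))).
  rewrite big_seq [leRHS]big_seq; apply: lee_sum => k.
  rewrite in_fset_set// inE => -[p _ pk].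
  have k0 : (0 <= k)%R by rewrite -pk fun_ge0.
  move: k0; rewrite le_eqVlt => /predU1P[<-|k0].
    by rewrite mul0e; exact: integral_rV_ge0.
  have uk : u @^-1` [set k] = A `&` u @^-1` [set k].
    apply/seteqP; split=> [q /= qk|q []//]; split=> //.
    by apply: contrapT => /uA; rewrite qk => kE; rewrite kE ltxx in k0.
  have mk : measurable (A `&` u @^-1` [set k]) by rewrite -uk; exact: measurable_sfunP.
  have Aki : A `&` u @^-1` [set k] `<=` dom M i by move=> q [/Ai].
  rewrite uk (riemannian_measureE gmu mk Aki).
  rewrite /chart_integral -integral_rVZl ?(ltW k0)//.
  have -> : F k = (fun y => k%:E * (\1_(chart M i @` (A `&` u @^-1` [set k])) y *
       (1 * W y))%:E); last exact: le_refl.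
  by apply/funext => y; rewrite /F ger0_norm ?(ltW k0)// mul1r EFinM.
apply: (le_trans (integral_rV_superadditive_sum _ _)) => //.
apply: le_integral_rV => [y|y]; first exact: sume_ge0.
have [[q Aq qy]|nA] := pselect ((chart M i @` A) y); last first.
  rewrite big1 ?lee_fin ?indicE ?memNset ?mul0r// => k _.
  by rewrite /F indicE memNset ?mul0r ?mulr0// => -[q [Aq _] qy]; apply: nA; exists q.
(* By injectivity of the chart on its domain, only the level of q contributes at y. *)
have FE k : F k y = ((k == u q)%:R * (u q * W y))%:E.
  rewrite /F indicE; congr EFin; have [->|kuq] := eqVneq k (u q).
    by rewrite mem_set ?mul1r ?ger0_norm ?fun_ge0//; exists q.
  rewrite memNset ?mul0r ?mulr0// => -[q' [Aq' uq'] q'y].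
  move/eqP: kuq; apply; rewrite -uq'; congr (u _).
  by apply: (@chart_inj i); [exact: Ai|exact: Ai|rewrite q'y].
under eq_bigr do rewrite FE.
rewrite (bigD1_seq (u q)) ?finmap.fset_uniq//=; last first.
  by rewrite in_fset_set// inE; exists q.
rewrite big1 => [|k /negbTE ->]; last by rewrite mul0r.
rewrite adde0 eqxx mul1r lee_fin indicE mem_set; last by exists q.
rewrite mul1r /W -qy chartK; last exact: Ai.
by rewrite ler_wpM2r ?sqrtr_ge0//; exact: uf'.
Qed.

(* The lower bound above, applied to [f] and to [b - f], is an equality because
   both sides are finite and the two bounds add up to [b * mu A]. *)
Lemma integral_chart_integral g mu i (A : set (borel M)) (f : M -> R) (b : R) :
  is_riemannian_measure g mu -> measurable A -> A `<=` dom M i ->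
  mu A < +oo -> measurable_fun [set: borel M] f ->
  (forall p, (0 <= f p <= b)%R) ->
  \int[mu]_(x in A) (f x)%:E = chart_integral g i A f.
Proof.
move=> gmu mA Ai muA mf fb.
have f0 p : (0 <= f p)%R by case/andP: (fb p).
have bf0 p : (0 <= b - f p)%R by rewrite subr_ge0; case/andP: (fb p).
have b0 : (0 <= b)%R by case/andP: (fb point); exact: le_trans.
apply/eqP; rewrite eq_le integral_le_chart_integral//=.
have mbf : measurable_fun [set: borel M] (fun p => b - f p)%R.
  by apply: measurable_funB => //; exact: measurable_cst.
have le2 := integral_le_chart_integral gmu mA Ai bf0.
have E : \int[mu]_(x in A) (f x)%:E + \int[mu]_(x in A) (b - f x)%:E = b%:E * mu A.
  rewrite -ge0_integralD//.
  - under eq_integral do rewrite -EFinD addrC subrK.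
    by rewrite integral_cst.
  - by move=> x _; rewrite lee_fin.
  - by apply/measurable_EFinP; exact: measurable_funTS.
  - by move=> x _; rewrite lee_fin.
  - by apply/measurable_EFinP; exact: measurable_funTS.
have fin1 : \int[mu]_(x in A) (b - f x)%:E \is a fin_num.
  rewrite ge0_fin_numE; last by apply: integral_ge0 => x _; rewrite lee_fin.
  apply: (@le_lt_trans _ _ (b%:E * mu A)); last by rewrite lte_mul_pinfty.
  by rewrite -E leeDr//; apply: integral_ge0 => x _; rewrite lee_fin.
rewrite -(leeD2rE _ _ fin1) E.
apply: (@le_trans _ _ (chart_integral g i A f + chart_integral g i A (fun p => b - f p)%R)).
  exact: leeD2l.
rewrite (riemannian_measureE gmu mA Ai) /chart_integral -integral_rVZl//.
apply: (le_trans (integral_rV_superadditive _ _)).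
- by move=> y; rewrite lee_fin !mulr_ge0// ?sqrtr_ge0// indicE.
- by move=> y; rewrite lee_fin !mulr_ge0// ?sqrtr_ge0// indicE.
apply: le_integral_rV => y.
  by rewrite adde_ge0// lee_fin !mulr_ge0// ?sqrtr_ge0// indicE.
by rewrite -EFinD -EFinM lee_fin -mulrDr -mulrDl addrC subrK mul1r mulrCA.
Qed.

End ConformalMeasure.

(** * Conformal invariance of the volume *)

Section DensityContinuity.
Variables (R : realType) (m n : nat) (M : manifold R m) (N : manifold R n).
Variables (g : metric M) (h : metric N).

Lemma differentialE (f : M -> N) i j p a b : smooth f -> dom M i p -> dom N j (f p) ->
  differential f i j p a b =
  ('D_(delta_mx 0 a : 'rV[R]_m) (local_repr f i j) (chart M i p)) 0 b.
Proof.
move=> fs ip jp.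
have := row_jacobian a (local_repr_differentiable fs ip jp).
by move=> /(congr1 (fun v : 'rV[R]_n => v 0 b)) <-; rewrite [RHS]mxE.
Qed.

Lemma near_charts (f : M -> N) i j p : smooth f -> dom M i p -> dom N j (f p) ->
  \forall q \near p, dom M i q /\ dom N j (f q).
Proof.
move=> [fc _] ip jp; apply: filterI; first exact: dom_nbhs.
exact: (fc p _ (dom_nbhs jp)).
Qed.

Lemma differential_continuous (f : M -> N) i j p a b : smooth f ->
  dom M i p -> dom N j (f p) ->
  {for p, continuous (fun q => differential f i j q a b)}.
Proof.
move=> fs ip jp; have [fc /(_ i j) fij] := fs.
apply: (@near_eq_continuous _ _ (fun q =>
    ('D_(delta_mx 0 a : 'rV[R]_m) (local_repr f i j) (chart M i q)) 0 b)).
  have := near_charts fs ip jp.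
  by apply: filterS => q [iq jq]; rewrite differentialE.
apply: (@continuous_for_comp _ _ _ _
  (fun q => 'D_(delta_mx 0 a : 'rV[R]_m) (local_repr f i j) (chart M i q))
  (fun A : 'rV[R]_n => A 0 b)); last exact: coord_continuous.
apply: (@continuous_for_comp _ _ _ _ (chart M i)
  (fun y => 'D_(delta_mx 0 a : 'rV[R]_m) (local_repr f i j) y)).
  exact: chart_continuous.
by apply: smooth_on_continuous (smooth_on_derive _ fij) _; exists p.
Qed.

Lemma pullback_in_continuous (f : M -> N) i j p a b : smooth f ->
  dom M i p -> dom N j (f p) ->
  {for p, continuous (fun q => pullback_in f h i j q a b)}.
Proof.
move=> fs ip jp; pose Q (u : M -> R) := {for p, continuous u}.
have Qc := @fring_continuous_cst R M p.
have QD := @fring_continuousD R M p.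
have QM := @fring_continuousM R M p.
apply: (fring_mulmx (Q := Q)) => // [k l|k l]; last first.
  by under eq_fun do rewrite mxE; exact: differential_continuous.
apply: (fring_mulmx (Q := Q)) => // [k' l'|k' l']; first exact: differential_continuous.
apply: (@continuous_for_comp _ _ _ _ f (fun q => h j q k' l')); last exact: metric_continuous.
by have [fc _] := fs; exact: fc.
Qed.

Lemma epsilon_continuous r (f : M -> N) : (r <= m)%N -> smooth f ->
  continuous (epsilon r g h f).
Proof.
move=> rm fs p; have ip := chart_at_dom p; have jp := chart_at_dom (f p).
set i := chart_at p in ip; set j := chart_at (f p) in jp.
pose Q (u : M -> R) := {for p, continuous u}.
have Qc := @fring_continuous_cst R M p.
have QD := @fring_continuousD R M p.
have QM := @fring_continuousM R M p.
have [fc _] := fs.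
apply: (@near_eq_continuous _ _ (fun q => (-1) ^+ r * ((\det (g i q))^-1 *
    (\det ('X *: map_mx polyC (g i q) -
           map_mx polyC (pullback_in f h i j q)))`_(m - r)))).
  have := near_charts fs ip jp.
  by apply: filterS => q [iq jq]; rewrite (epsilonE g h rm fs iq jq).
apply: (QM _ _ (Qc _)); apply: (QM (fun q => (\det (g i q))^-1)).
  apply: continuousV; last exact: metric_det_continuous.
  by rewrite -unitfE -unitmxE metric_unitmx.
apply: (fring_char_poly_mulV (Q := Q)) => // a b.
  exact: pullback_in_continuous.
exact: metric_continuous.
Qed.

Lemma volume_density_continuous (f : M -> N) : smooth f ->
  continuous (volume_density g h f).
Proof.
move=> fs p; have ip := chart_at_dom p; have jp := chart_at_dom (f p).
set i := chart_at p in ip; set j := chart_at (f p) in jp.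
pose Q (u : M -> R) := {for p, continuous u}.
have Qc := @fring_continuous_cst R M p.
have QD := @fring_continuousD R M p.
have QM := @fring_continuousM R M p.
have [fc _] := fs.
apply: (@near_eq_continuous _ _ (fun q =>
    Num.sqrt (\det (pullback_in f h i j q) * (\det (g i q))^-1))).
  have := near_charts fs ip jp.
  by apply: filterS => q [iq jq]; rewrite (volume_densityE g h fs iq jq).
apply: (@continuous_for_comp _ _ _ _ (fun q =>
  \det (pullback_in f h i j q) * (\det (g i q))^-1)); last exact: sqrt_continuous.
apply: (QM (fun q => \det (pullback_in f h i j q))).
  by apply: (fring_det (Q := Q)) => // a b; exact: pullback_in_continuous.
apply: continuousV; last exact: metric_det_continuous.
by rewrite -unitfE -unitmxE metric_unitmx.
Qed.

End DensityContinuity.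

Section ConformalInvariance.
Variables (R : realType) (r : nat) (hr : (1 <= r)%N) (M : manifold R (2 * r)).
Hypothesis cM : compact [set: M].

Lemma conformal_factor_continuous (g g' : metric M) (c : M -> R) :
  (forall i p, dom M i p -> g' i p = c p *: g i p) -> continuous c.
Proof.
move=> gg' p; have ip := chart_at_dom p; set i := chart_at p in ip.
have r2 : (0 < 2 * r)%N by rewrite muln_gt0.
(* Positive dimension provides an index, and the corresponding diagonal entry of a metric is a
   positive denominator for c. *)
pose a := Ordinal r2.
have gaa q : dom M i q -> 0 < g i q a a.
  move=> iq.
  have d0 : delta_mx 0 a != 0 :> 'rV[R]_(2 * r).
    apply/eqP => /(congr1 (fun v : 'rV[R]_(2 * r) => v 0 a)).
    by rewrite !mxE !eqxx => /eqP; rewrite oner_eq0.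
  have := metric_pos g iq d0.
  by rewrite -rowE trmx_delta -colE !mxE.
apply: (@near_eq_continuous _ _ (fun q => g' i q a a * (g i q a a)^-1)).
  by apply: filterS (dom_nbhs ip) => q iq; rewrite gg'// mxE mulfK// gt_eqF// gaa.
apply: (@fring_continuousM R M p (fun q => g' i q a a)); first exact: metric_continuous.
by apply: continuousV; [rewrite gt_eqF// gaa|exact: metric_continuous].
Qed.

Lemma sqrt_exprM_even (c x : R) : 0 < c ->
  Num.sqrt (c ^+ (2 * r) * x) = c ^+ r * Num.sqrt x.
Proof.
move=> c0; rewrite sqrtrM ?exprn_ge0 ?(ltW c0)//.
by rewrite [(2 * r)%N]mulnC exprM sqrtr_sqr ger0_norm// exprn_ge0// ltW.
Qed.

(** In dimension 2r, sqrt (det (c g)) = c^r sqrt (det g), so the measure of density c^r with respect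
    to [mu] has the chart expression required for g'. *)
Lemma exists_conformal_measure (g g' : metric M) (c : M -> R) mu :
  (forall p, 0 < c p) -> (forall i p, dom M i p -> g' i p = c p *: g i p) ->
  is_riemannian_measure g mu ->
  exists2 nu : {measure set (borel M) -> \bar R}, is_riemannian_measure g' nu &
    forall f : M -> R, (forall p, 0 <= f p) -> measurable_fun [set: borel M] f ->
      (\int[nu]_x (f x)%:E = \int[mu]_x (f x * c x ^+ r)%:E)%E.
Proof.
move=> c0 gg' gmu; pose w p := c p ^+ r.
have cw : continuous w.
  move=> p; apply: (@continuous_for_comp _ _ _ _ c (fun x => x ^+ r)).
    exact: (conformal_factor_continuous gg').
  exact: exprn_continuous.
have w0 (p : borel M) : 0 <= w p by rewrite exprn_ge0// ltW.
have mw : measurable_fun [set: borel M] w by exact: continuous_measurable_borel.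
exists (density mu w0 mw); last by move=> f f0 mf; rewrite integral_density.
(* Compactness bounds the density, as the equality of integrals in a chart requires. *)
have [q _ qmax] : exists2 q, q \in [set: M] & forall t, t \in [set: M] -> w t <= w q.
  by apply: compact_EVT_max => //; [exists point|exact: continuous_subspaceT].
have wb p : 0 <= w p <= w q by rewrite w0/= qmax// inE.
move=> i A mA Ai.
have muA := riemannian_measure_fin cM gmu mA.
have -> : density mu w0 mw A = (\int[mu]_(x in A) (w x)%:E)%E by [].
rewrite (integral_chart_integral gmu mA Ai muA mw wb) /chart_integral.
congr integral_rV; apply/funext => y.
have [[p Ap <-]|nA] := pselect ((chart M i @` A) y); last first.
  by rewrite indicE memNset// !mul0r.
rewrite chartK; last exact: Ai.
by rewrite gg' ?detZ ?sqrt_exprM_even//; exact: Ai.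
Qed.

Lemma vol_riemannian (g : metric M) :
  (exists mu, is_riemannian_measure g mu) -> is_riemannian_measure g (vol g).
Proof.
move=> ex; rewrite /vol; case: pselect => [ex'|//].
exact: projT2 (cid ex').
Qed.

Lemma volume_conformal n (N : manifold R n) (h : metric N) (g g' : metric M)
    (c : M -> R) (f : M -> N) :
  (forall p, 0 < c p) -> (forall i p, dom M i p -> g' i p = c p *: g i p) ->
  smooth f -> volume g' h f = volume g h f.
Proof.
move=> c0 gg' fs.
(* If [g] had no Riemannian measure then neither would [g'], and [vol] would
   be [mzero] for both: the change of variables formula is not needed. *)
have [ex|nex] := pselect (exists mu, is_riemannian_measure g mu); last first.
  have nex' : ~ exists mu, is_riemannian_measure g' mu.
    move=> [mu' gmu']; apply: nex.
    have [] := @exists_conformal_measure g' g (fun p => (c p)^-1) mu' _ _ gmu'.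
    - by move=> p; rewrite invr_gt0.
    - by move=> i p ip; rewrite gg'// scalerA mulVf ?scale1r// gt_eqF.
    - by move=> nu gnu _; exists nu.
  rewrite /volume /vol; case: pselect => // _; case: pselect => // _.
  by rewrite /Rintegral !integral_measure_zero.
have gmu := vol_riemannian ex.
have [nu gnu nuE] := exists_conformal_measure c0 gg' gmu.
have gmu' : is_riemannian_measure g' (vol g') by apply: vol_riemannian; exists nu.
rewrite /volume /Rintegral; congr fine.
rewrite (eq_measure_integral nu) => [|A mA _]; last first.
  exact: riemannian_measure_unique gmu' gnu _ mA.
rewrite nuE; last 2 first.
- by move=> p; rewrite sqrtr_ge0.
- by apply: continuous_measurable_borel; exact: volume_density_continuous.
apply: eq_integral => p _; congr EFin.
have ip := chart_at_dom p.
(* Passing to g' divides [alpha] by c, hence the root of its determinant by c^r, which cancels the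
   density of the measure. *)
rewrite /volume_density /alpha gg'// invmxZ; last first.
  by rewrite -gg'// metric_unitmx.
rewrite -scalemxAr detZ exprVn.
rewrite mulrC -sqrt_exprM_even// mulrA divff ?mul1r//.
by rewrite expf_neq0// gt_eqF.
Qed.

End ConformalInvariance.

(** * First variation *)

(* [sdiff p0 f] : near [(0, p0)], [f] has a first order expansion in the time
   variable, with a remainder that is uniform in the space variable. *)
Section StrictDifferentiability.
Variables (R : realType) (M : topologicalType) (p0 : M).
Implicit Types f : R * M -> R.

(** A symmetric time interval can be used in the product neighbourhood. This gives access to the
    times 0 and -t and to all times between 0 and t. *)
Lemma near_slab (P : set (R * M)) : (\forall z \near ((0 : R), p0), P z) ->
  \forall z \near ((0 : R), p0), forall s, `|s| <= `|z.1| -> P (s, z.2).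
Proof.
move=> [[A V] /= [A0 Vp] AVP].
have [d d0 dA] := (nbhs_normP _ _).1 A0.
exists ([set t : R | `|t| < d], V) => /=.
  by split=> //; apply/nbhs_normP; exists d => //= t; rewrite /= sub0r normrN.
move=> [t p] /= [td Vp'] s st; apply: AVP; split=> //=; apply: dA.
by rewrite /= sub0r normrN; exact: le_lt_trans td.
Qed.

Lemma near_time0 (P : set (R * M)) : (\forall z \near ((0 : R), p0), P z) ->
  \forall z \near ((0 : R), p0), P (0, z.2).
Proof. by move=> /near_slab; apply: filterS => z; apply; rewrite normr0. Qed.

Lemma near_space (P : set M) : (\forall p \near p0, P p) ->
  \forall z \near ((0 : R), p0), P z.2.
Proof. by move=> Pp; exact: (cvg_snd (F := nbhs (0 : R)) Pp). Qed.

Lemma near_time (P : set R) : (\forall t \near (0 : R), P t) ->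
  \forall z \near ((0 : R), p0), P z.1.
Proof. by move=> Pt; exact: (cvg_fst (G := nbhs p0) Pt). Qed.

Lemma near_time_small (d : R) : 0 < d -> \forall z \near ((0 : R), p0), `|z.1| < d.
Proof.
move=> d0; apply: (near_time (P := fun t => `|t| < d)).
by apply/nbhs_normP; exists d => //= t; rewrite /= sub0r normrN.
Qed.

Definition sdiff f := exists (D : M -> R) (b : R),
  (\forall z \near ((0 : R), p0), `|f (0, z.2)| <= b /\ `|D z.2| <= b) /\
  forall e, 0 < e -> \forall z \near ((0 : R), p0),
    `|f z - f (0, z.2) - z.1 * D z.2| <= e * `|z.1|.

Lemma sdiff_cst c : sdiff (fun=> c).
Proof.
exists (fun=> 0), `|c|; split.
  by near=> z; rewrite normr0 lexx.
move=> e e0; near=> z; rewrite mulr0 subr0 subrr normr0.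
by rewrite mulr_ge0// ltW.
Unshelve. all: by end_near. Qed.

Lemma sdiffD f g : sdiff f -> sdiff g -> sdiff (fun z => f z + g z).
Proof.
move=> [D [b [Db fD]]] [E [c [Ec gE]]].
exists (fun p => D p + E p), (b + c); split.
  near=> z.
  have [] : `|f (0, z.2)| <= b /\ `|D z.2| <= b by near: z.
  have [] : `|g (0, z.2)| <= c /\ `|E z.2| <= c by near: z.
  by move=> *; split; apply: (le_trans (ler_normD _ _)); exact: lerD.
move=> e e0; have e20 : 0 < e / 2 by rewrite divr_gt0.
near=> z.
have -> : f z + g z - (f (0, z.2) + g (0, z.2)) - z.1 * (D z.2 + E z.2) =
  (f z - f (0, z.2) - z.1 * D z.2) + (g z - g (0, z.2) - z.1 * E z.2) by ring.
apply: (le_trans (ler_normD _ _)).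
rewrite [e]splitr mulrDl lerD//; near: z; [exact: fD|exact: gE].
Unshelve. all: by end_near. Qed.

Lemma sdiffM f g : sdiff f -> sdiff g -> sdiff (fun z => f z * g z).
Proof.
move=> [D [b [Db fD]]] [E [c [Ec gE]]].
pose k := 1 + `|b| + `|c|.
have bk : b <= k by rewrite /k (le_trans (ler_norm b))// -addrA addrCA lerDl addr_ge0.
have ck : c <= k by rewrite /k (le_trans (ler_norm c))// lerDr addr_ge0.
have k1 : 1 <= k by rewrite /k -addrA lerDl addr_ge0.
have k0 : 0 < k by exact: lt_le_trans k1.
exists (fun p => D p * g (0, p) + f (0, p) * E p), (k * k + k * k); split.
  near=> z.
  have [f0 D0] : `|f (0, z.2)| <= b /\ `|D z.2| <= b by near: z.
  have [g0 E0] : `|g (0, z.2)| <= c /\ `|E z.2| <= c by near: z.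
  have [f0' D0'] := (le_trans f0 bk, le_trans D0 bk).
  have [g0' E0'] := (le_trans g0 ck, le_trans E0 ck).
  split; last first.
    by apply: (le_trans (ler_normD _ _)); rewrite !normrM lerD// ler_pM.
  rewrite normrM (@le_trans _ _ (k * k))// ?ler_pM// lerDl.
  by rewrite mulr_ge0// ltW.
move=> e e0.
(* The remainder of the product splits into six terms, each at most d k^2 |t|. The cap at 1 ensures
   |t| <= 1 and keeps the remainder of [f] below k. *)
pose d := Num.min 1 (e / (6 * k * k)).
have kk0 : 0 < 6 * k * k by rewrite !mulr_gt0.
have d0 : 0 < d by rewrite lt_min ltr01/= divr_gt0.
near=> z.
have [f0 D0] : `|f (0, z.2)| <= b /\ `|D z.2| <= b by near: z.
have [g0 E0] : `|g (0, z.2)| <= c /\ `|E z.2| <= c by near: z.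
have [f0' D0'] := (le_trans f0 bk, le_trans D0 bk).
have [g0' E0'] := (le_trans g0 ck, le_trans E0 ck).
have fe : `|f z - f (0, z.2) - z.1 * D z.2| <= d * `|z.1| by near: z; exact: fD.
have ge : `|g z - g (0, z.2) - z.1 * E z.2| <= d * `|z.1| by near: z; exact: gE.
have zd : `|z.1| < d by near: z; exact: near_time_small.
move: f0' D0' g0' E0' fe ge zd {f0 D0 g0 E0}.
move: (f z) (f (0, z.2)) (D z.2) (g z) (g (0, z.2)) (E z.2) (z.1).
move=> u u0 Du v v0 Ev t hu0 hDu hv0 hEv hu hv td.
have d1 : d <= 1 by rewrite ge_min lexx.
have de : d * (6 * k * k) <= e by rewrite -ler_pdivlMr// ge_min lexx orbT.
set a := u - u0 - t * Du in hu; set a' := v - v0 - t * Ev in hv.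
have -> : u * v - u0 * v0 - t * (Du * v0 + u0 * Ev) =
  a * v0 + a * (t * Ev) + a * a' + u0 * a' + t * Du * a' + t * (t * (Du * Ev)).
  by rewrite /a /a'; ring.
have t1 : `|t| <= 1 by rewrite (le_trans (ltW td)).
have T0 := normr_ge0 t.
have hu1 : `|a| <= k by apply: (le_trans hu); rewrite (le_trans _ k1)// mulr_ile1// ltW.
have X : d * `|t| * k <= d * (k * k) * `|t|.
  rewrite -mulrA [`|t| * k]mulrC mulrA ler_wpM2r// -[leLHS]mulr1 -mulrA ler_wpM2l ?(ltW d0)//.
  by rewrite mulr1 ler_peMl// ltW.
have Y x y : `|x| <= d * `|t| -> `|y| <= k -> `|x * y| <= d * (k * k) * `|t|.
  by move=> hx hy; apply: le_trans X; rewrite normrM ler_pM.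
have tE : `|t * Ev| <= k by rewrite normrM -[k]mul1r ler_pM.
have tD : `|t * Du| <= k by rewrite normrM -[k]mul1r ler_pM.
have Z : `|t * (t * (Du * Ev))| <= d * (k * k) * `|t|.
  rewrite !normrM mulrC ler_wpM2r// ler_pM ?mulr_ge0//; first exact: ltW.
  exact: ler_pM.
apply: (@le_trans _ _ (6 * (d * (k * k) * `|t|))); last first.
  rewrite (_ : 6 * _ = d * (6 * k * k) * `|t|); last by ring.
  by rewrite ler_wpM2r.
have -> : 6 * (d * (k * k) * `|t|) = d * (k * k) * `|t| + d * (k * k) * `|t| +
   d * (k * k) * `|t| + d * (k * k) * `|t| + d * (k * k) * `|t| + d * (k * k) * `|t| by ring.
do 5 (apply: (le_trans (ler_normD _ _)); apply: lerD; last by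
  first [exact: Z | exact: Y | rewrite mulrC; exact: Y]).
exact: Y.
Unshelve. all: by end_near. Qed.

Lemma near_eq_sdiff f g : (\forall z \near ((0 : R), p0), f z = g z) ->
  sdiff f -> sdiff g.
Proof.
move=> fg [D [b [Db fD]]]; have fg0 := near_time0 fg.
exists D, b; split=> [|e e0]; near=> z.
  by rewrite -(near fg0 z)//; near: z.
rewrite -(near fg0 z)// -(near fg z)//; near: z; exact: fD.
Unshelve. all: by end_near. Qed.

Lemma sdiff_symmetric f e : sdiff f -> 0 < e -> \forall z \near ((0 : R), p0),
  `|f z + f (- z.1, z.2) - 2 * f (0, z.2)| <= e * `|z.1|.
Proof.
move=> [D [b [_ fD]]] e0; have e20 : 0 < e / 2 by rewrite divr_gt0.
have /near_slab near_fD := fD _ e20; near=> z.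
have h1 : forall s, `|s| <= `|z.1| ->
    `|f (s, z.2) - f (0, z.2) - s * D z.2| <= e / 2 * `|s| by near: z.
have -> : f z + f (- z.1, z.2) - 2 * f (0, z.2) =
    (f (z.1, z.2) - f (0, z.2) - z.1 * D z.2) +
    (f (- z.1, z.2) - f (0, z.2) - (- z.1) * D z.2).
  by rewrite -surjective_pairing; ring.
apply: (le_trans (ler_normD _ _)).
rewrite [e]splitr mulrDl lerD ?h1//.
by have := h1 (- z.1); rewrite normrN; exact.
Unshelve. all: by end_near. Qed.

Lemma sdiff_space (v : M -> R) : {for p0, continuous v} -> sdiff (fun z => v z.2).
Proof.
move=> cv; exists (fun=> 0), (`|v p0| + 1); split.
  near=> z; rewrite normr0; split; last by rewrite addr_ge0.
  have : `|v p0 - v z.2| < 1.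
    near: z; apply: (near_space (P := fun p => `|v p0 - v p| < 1)).
    by have /cvgrPdist_lt/(_ 1 ltr01) := cv.
  move=> h; rewrite -[v z.2](subrK (v p0)) addrC (le_trans (ler_normD _ _))//.
  by rewrite lerD2l distrC ltW.
move=> e e0; near=> z; rewrite mulr0 subr0 subrr normr0.
by rewrite mulr_ge0// ltW.
Unshelve. all: by end_near. Qed.

(** The mean value theorem is applied to s |-> f(s,p) - s f'(0,p). Joint continuity of f' at (0,p0)
    makes its derivative at most e for all p near p0 at once, whence the uniform remainder. *)
Lemma sdiff_derive f f' :
  (\forall z \near ((0 : R), p0), is_derive z.1 (1 : R) (fun t => f (t, z.2) : R) (f' z)) ->
  {for ((0 : R), p0), continuous f'} -> {for p0, continuous (fun p => f (0, p))} ->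
  sdiff f.
Proof.
move=> /near_slab ff' cf' cf.
exists (fun p => f' (0, p)), (`|f (0, p0)| + `|f' (0, p0)| + 1).
have near1 (T : topologicalType) (x : T) (g : T -> R) : {for x, continuous g} ->
    \forall y \near x, `|g y| <= `|g x| + 1.
  move=> /cvgrPdist_lt/(_ 1 ltr01); apply: filterS => y h.
  rewrite -[g y](subrK (g x)) addrC (le_trans (ler_normD _ _))//.
  by rewrite lerD2l distrC ltW.
split.
  have := near1 _ _ _ cf => /near_space near_f.
  have := near1 _ _ _ cf' => /near_time0 near_f'.
  near=> z; split.
    apply: (@le_trans _ _ (`|f (0, p0)| + 1)); first by near: z.
    by rewrite addrAC lerDl.
  apply: (@le_trans _ _ (`|f' (0, p0)| + 1)); first by near: z.
  by rewrite -addrA lerDr.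
move=> e e0; have e20 : 0 < e / 2 by rewrite divr_gt0.
have : \forall z \near ((0 : R), p0), `|f' (0, p0) - f' z| < e / 2.
  by have /cvgrPdist_lt/(_ _ e20) := cf'.
move=> /near_slab near_e; near=> z.
have h1 : forall s, `|s| <= `|z.1| ->
    is_derive s (1 : R) (fun t => f (t, z.2) : R) (f' (s, z.2)) by near: z.
have h2 : forall s, `|s| <= `|z.1| -> `|f' (0, p0) - f' (s, z.2)| < e / 2 by near: z.
rewrite [z]surjective_pairing /=; move: h1 h2; move: z.1 z.2 => t p h1 h2.
pose u s := f (s, p) - s * f' (0, p).
have du s : `|s| <= `|t| -> is_derive s (1 : R) u (f' (s, p) - f' (0, p)).
  move=> st; have := h1 _ st => hs.
  have : is_derive s (1 : R) (fun s : R => s * f' (0, p)) (f' (0, p)).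
    have -> : (fun s : R => s * f' (0, p)) = f' (0, p) \*: (id : R -> R^o).
      by apply/funext => x /=; rewrite mulrC.
    by apply: is_derive_eq; rewrite /GRing.scale/= mulr1.
  exact: is_deriveB.
have df s : `|s| <= `|t| -> `|f' (s, p) - f' (0, p)| <= e.
  move=> st; rewrite -(subrKA (f' (0, p0))) (le_trans (ler_normD _ _))//.
  rewrite [e]splitr lerD// ltW//; first by rewrite distrC; exact: h2.
  by apply: h2; rewrite normr0.
have -> : f (t, p) - f (0, p) - t * f' (0, p) = u t - u 0.
  by rewrite /u mul0r subr0; ring.
have cu a b : (forall s, s \in `[a, b]%R -> `|s| <= `|t|) ->
    {within `[a, b], continuous u}.
  move=> ab; apply: derivable_within_continuous => s sab.
  by have [] := du s (ab s sab).
have [t0|t0] := leP 0 t.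
  have st s : s \in `[0, t]%R -> `|s| <= `|t|.
    by rewrite in_itv/= => /andP[s0 st]; rewrite !ger0_norm.
  have [c ct ->] := MVT_segment t0
    (fun s sI => du s (st s (subset_itv_oo_cc sI))) (cu _ _ st).
  by rewrite subr0 normrM ler_wpM2r// df// st.
have st s : s \in `[t, 0]%R -> `|s| <= `|t|.
  by rewrite in_itv/= => /andP[s0 st]; rewrite !ler0_norm ?(ltW t0)// lerN2.
have [c ct E] := MVT_segment (ltW t0)
  (fun s sI => du s (st s (subset_itv_oo_cc sI))) (cu _ _ st).
rewrite distrC E sub0r normrM normrN ler_wpM2r// df// st//.
Unshelve. all: by end_near. Qed.

End StrictDifferentiability.

Lemma continuous_for_pair (T U V : topologicalType) (f : T -> U) (g : T -> V) x :
  {for x, continuous f} -> {for x, continuous g} ->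
  {for x, continuous (fun y => (f y, g y))}.
Proof. by move=> cf cg; exact: (cvg_pair cf cg). Qed.

(** * Time and space slices of maps on a product *)

Section Slices.
Variables (R : realType) (V W : normedModType R).

Lemma slice_time_quotient (u : (R^o * V)%type -> W) (t : R) (y : V) (k : R) :
  k^-1 *: (u (k *: (1 : R^o) + t, y) - u (t, y)) =
  k^-1 *: (u (k *: ((1 : R^o), (0 : V)) + ((t : R^o), y)) - u (t, y)).
Proof. by congr (_ *: (u (_, _) - _)); rewrite /= scaler0 add0r. Qed.

Lemma derive_slice_time (u : (R^o * V)%type -> W) (t : R) (y : V) :
  'D_(1 : R) (fun s : R => u (s, y)) t = 'D_((1 : R^o), (0 : V)) u ((t : R^o), y).
Proof.
by rewrite /derive; apply: (congr1 (fun q : R -> W => lim (q @ 0^'))); apply/funext => k; exact: (slice_time_quotient u t y k).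
Qed.

Lemma derivable_slice_time (u : (R^o * V)%type -> W) (t : R) (y : V) :
  derivable u ((t : R^o), y) ((1 : R^o), (0 : V)) ->
  derivable (fun s : R => u (s, y)) t (1 : R).
Proof.
move=> du; rewrite /derivable.
suff -> : (fun k : R => k^-1 *: (((fun s : R => u (s, y)) \o shift t) (k *: (1 : R)) - u (t, y))) =
    (fun k : R => k^-1 *: ((u \o shift ((t : R^o), y)) (k *: ((1 : R^o), (0 : V))) - u (t, y))) by exact: du.
apply/funext => k.
exact: (slice_time_quotient u t y k).
Qed.

Lemma derive_slice_space (u : (R^o * V)%type -> W) (t : R) (y v : V) :
  'D_v (fun x => u (t, x)) y = 'D_((0 : R^o), v) u ((t : R^o), y).
Proof.
rewrite /derive; apply: (congr1 (fun q : R -> W => lim (q @ 0^'))); apply/funext => k.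
by congr (_ *: (u (_, _) - _)); rewrite /= scaler0 add0r.
Qed.

Lemma slice_differentiable (u : (R^o * V)%type -> W) (t : R) (y : V) :
  differentiable u ((t : R^o), y) -> differentiable (fun x => u (t, x)) y.
Proof.
by move=> du; apply: (@differentiable_comp _ _ _ _ (fun x : V => ((t : R^o), x)) u).
Qed.

Lemma Cn_on_slice (k : nat) (U : set (R^o * V)%type) (u : (R^o * V)%type -> W) (t : R) :
  Cn_on k U u -> Cn_on k [set y | U (t, y)] (fun y => u (t, y)).
Proof.
elim: k u => [|k IH] u /=.
  move=> cu y Uy; apply: (@continuous_for_comp _ _ _ _ (fun x : V => ((t : R^o), x)) u).
    by apply: continuous_for_pair; [exact: cst_continuous|exact: cvg_id].
  exact: (cu ((t : R^o), y) Uy).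
move=> [du Du]; split=> [y Uy|v]; first exact: slice_differentiable (du ((t : R^o), y) Uy).
have -> : (fun y => 'D_v (fun x => u (t, x)) y) =
    (fun y => 'D_((0 : R^o), v) u ((t : R^o), y)).
  by apply/funext => y; exact: derive_slice_space.
exact: (IH (fun z => 'D_((0 : R^o), v) u z) (Du _)).
Qed.

Lemma Cn_on_sub (k : nat) (U U' : set V) (u : V -> W) :
  U `<=` U' -> Cn_on k U' u -> Cn_on k U u.
Proof.
move=> UU'; elim: k u => [|k IH] u /=; first by move=> cu x /UU'; exact: cu.
by move=> [du Du]; split=> [x /UU'|v]; [exact: du|exact/IH/Du].
Qed.

End Slices.

(** * First order expansion of the energy density along a variation *)

Section Variation.
Variables (R : realType) (m n : nat) (M : manifold R m) (N : manifold R n).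
Variables (f : M -> N) (e : R) (F : R -> M -> N).
Hypothesis vF : smooth_variation f e F.

Definition variation_repr i j : (R^o * 'rV[R]_m)%type -> 'rV[R]_n :=
  fun z => chart N j (F z.1 (chart_inv M i z.2)).

Definition variation_dom i j : set (R^o * 'rV[R]_m)%type :=
  [set z : (R^o * 'rV[R]_m)%type | exists t p,
     [/\ `|t| < e, dom M i p, dom N j (F t p) & z = (t, chart M i p)]].

Lemma variation_repr_smooth i j : smooth_on (variation_dom i j) (variation_repr i j).
Proof. by have [_ _ _ sF] := vF; exact: sF. Qed.

Lemma variation_continuous (t : R) (p : M) : `|t| < e ->
  {for (t, p), continuous (fun q : R * M => F q.1 q.2)}.
Proof. by have [_ _ + _] := vF; exact. Qed.

Lemma variation_smooth (t : R) : `|t| < e -> smooth (F t).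
Proof.
move=> te; split=> [p|i j k].
  apply: (@continuous_for_comp _ p _ _ (fun x : M => (t, x)) (fun q : R * M => F q.1 q.2)).
    by apply: continuous_for_pair; [exact: cst_continuous|exact: cvg_id].
  exact: variation_continuous.
have := Cn_on_slice t (variation_repr_smooth i j k).
by apply: Cn_on_sub => _ [p [ip jp] <-]; exists t, p.
Qed.

Lemma near_variation_charts (p0 : M) i j : dom M i p0 -> dom N j (F 0 p0) ->
  \forall z \near ((0 : R), p0), [/\ `|z.1| < e, dom M i z.2 & dom N j (F z.1 z.2)].
Proof.
have [e0 _ _ _] := vF.
move=> ip jp.
have c0 : {for ((0 : R), p0), continuous (fun q : R * M => F q.1 q.2)}.
  by apply: variation_continuous; rewrite normr0.
have near_j : \forall z \near ((0 : R), p0), dom N j (F z.1 z.2) by apply: c0; exact: dom_nbhs.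
near=> z; split.
- by near: z; exact: near_time_small.
- by near: z; apply: near_space; exact: dom_nbhs.
- by near: z.
Unshelve. all: by end_near. Qed.

Section AtPoint.
Variables (p0 : M) (i : chart_index M) (j : chart_index N).
Hypotheses (ip : dom M i p0) (jp : dom N j (F 0 p0)).

Definition space_chart (z : R * M) : (R^o * 'rV[R]_m)%type := (z.1, chart M i z.2).

Lemma space_chart_continuous (t : R) p : dom M i p ->
  {for (t, p), continuous space_chart}.
Proof.
move=> ip'; apply: continuous_for_pair; first exact: cvg_fst.
apply: (@continuous_for_comp _ (t, p) _ _ snd (chart M i)); first exact: cvg_snd.
exact: chart_continuous.
Qed.

Lemma sdiff_chart (k l : nat) (u : (R^o * 'rV[R]_m)%type -> 'M[R]_(k, l)) a b :
  (\forall z \near ((0 : R), p0), differentiable u (space_chart z)) ->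
  {for ((0 : R), p0), continuous
    (fun z => 'D_((1 : R^o), (0 : 'rV[R]_m)) u (space_chart z) a b)} ->
  sdiff p0 (fun z => u (space_chart z) a b).
Proof.
move=> du cDu; apply: (sdiff_derive _ cDu).
  near=> z.
  have duz : differentiable u (space_chart z) by near: z.
  have dt : derivable (fun s : R => u ((s : R^o), chart M i z.2)) z.1 (1 : R).
    by apply: derivable_slice_time; exact: diff_derivable.
  apply: DeriveDef; first exact: (derivable_mxP _ _ _).1 dt a b.
  have := derive_mx dt => /(congr1 (fun A : 'M[R]_(k, l) => A a b)).
  by rewrite mxE derive_slice_time => <-.
have du0 : differentiable u (space_chart (0, p0)) by exact: nbhs_singleton du.
apply: (@continuous_for_comp _ p0 _ _ (fun p => u (space_chart (0, p)))
  (fun A : 'M[R]_(k, l) => A a b)); last exact: coord_continuous.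
apply: (@continuous_for_comp _ p0 _ _ (fun p => space_chart (0, p)) u).
  apply: (@continuous_for_comp _ p0 _ _ (fun p => ((0 : R), p)) space_chart).
    by apply: continuous_for_pair; [exact: cst_continuous|exact: cvg_id].
  exact: space_chart_continuous.
exact: differentiable_continuous.
Unshelve. all: by end_near. Qed.

Lemma near_variation_dom :
  \forall z \near ((0 : R), p0), variation_dom i j (space_chart z).
Proof.
have := near_variation_charts ip jp; apply: filterS => z [te iz jz].
by exists z.1, z.2.
Qed.

Lemma variation_dom0 : variation_dom i j (space_chart (0, p0)).
Proof. exact: nbhs_singleton near_variation_dom. Qed.

Lemma sdiff_smooth (k l : nat) (u : (R^o * 'rV[R]_m)%type -> 'M[R]_(k, l)) a b :
  smooth_on (variation_dom i j) u -> sdiff p0 (fun z => u (space_chart z) a b).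
Proof.
move=> su; apply: sdiff_chart.
  apply: filterS near_variation_dom => z; exact: smooth_on_differentiable.
apply: (@continuous_for_comp _ _ _ _
  (fun z => 'D_((1 : R^o), (0 : 'rV[R]_m)) u (space_chart z))
  (fun A : 'M[R]_(k, l) => A a b)); last exact: coord_continuous.
apply: (@continuous_for_comp _ _ _ _ space_chart
  (fun z => 'D_((1 : R^o), (0 : 'rV[R]_m)) u z)).
  exact: space_chart_continuous.
exact: smooth_on_continuous (smooth_on_derive _ su) variation_dom0.
Qed.

Lemma derive_row_sum (W : normedModType R) (u : 'rV[R]_n -> W) x v :
  differentiable u x ->
  'D_v u x = \sum_(b < n) v 0 b *: 'D_(delta_mx 0 b : 'rV[R]_n) u x.
Proof.
move=> du; rewrite deriveE// [v in LHS]row_sum_delta linear_sum.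
by apply: eq_bigr => b _; rewrite linearZ deriveE.
Qed.

(** One time derivative of the composite suffices: the chain rule writes it as a sum of products of
    derivatives of [G] and [H], which are continuous because each factor is smooth. *)
Lemma sdiff_metric (h : metric N) a b : sdiff p0 (fun z => h j (F z.1 z.2) a b).
Proof.
pose H := h j \o chart_inv N j.
pose G := variation_repr i j.
have sH : smooth_on (chart N j @` dom N j) H by exact: metric_smooth.
have sG : smooth_on (variation_dom i j) G by exact: variation_repr_smooth.
have GZ z : variation_dom i j z -> (chart N j @` dom N j) (G z).
  by move=> [t [p [te ip' jp' ->]]]; exists (F t p) => //; rewrite /G/variation_repr/= chartK.
have dHG z : variation_dom i j z -> differentiable (H \o G) z.
  move=> Zz; apply: differentiable_comp; first exact: smooth_on_differentiable sG Zz.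
  exact: smooth_on_differentiable sH (GZ _ Zz).
apply: (@near_eq_sdiff _ _ _ (fun z => (H \o G) (space_chart z) a b)).
  have := near_variation_charts ip jp; apply: filterS => z [te iz jz].
  by rewrite /H /G /variation_repr/= chartK// chartK.
apply: sdiff_chart.
  apply: filterS near_variation_dom => z; exact: dHG.
pose d z := 'D_((1 : R^o), (0 : 'rV[R]_m)) G z.
apply: (@near_eq_continuous _ _ (fun z => \sum_(c < n) d (space_chart z) 0 c *
    'D_(delta_mx 0 c : 'rV[R]_n) H (G (space_chart z)) a b)).
  apply: filterS near_variation_dom => z Zz.
  rewrite (derive_comp _ (smooth_on_differentiable sG Zz)
    (smooth_on_differentiable sH (GZ _ Zz))).
  rewrite (derive_row_sum _ (smooth_on_differentiable sH (GZ _ Zz))).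
  by rewrite summxE; apply: eq_bigr => c _; rewrite mxE.
pose Q (u : R * M -> R) := {for ((0 : R), p0), continuous u}.
apply: (fring_sum (Q := Q)).
- exact: fring_continuous_cst.
- exact: fring_continuousD.
have cS : {for ((0 : R), p0), continuous space_chart} by exact: space_chart_continuous.
have cd : {for ((0 : R), p0), continuous (fun z => d (space_chart z))}.
  apply: (@continuous_for_comp _ _ _ _ space_chart d) => //.
  exact: smooth_on_continuous (smooth_on_derive _ sG) variation_dom0.
have cG : {for ((0 : R), p0), continuous (fun z => G (space_chart z))}.
  apply: (@continuous_for_comp _ _ _ _ space_chart G) => //.
  exact: smooth_on_continuous sG variation_dom0.
move=> c; apply: fring_continuousM.
  by apply: (@continuous_for_comp _ _ _ _ (fun z => d (space_chart z))
    (fun A : 'rV[R]_n => A 0 c)) => //; exact: coord_continuous.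
apply: (@continuous_for_comp _ _ _ _
  (fun z => 'D_(delta_mx 0 c : 'rV[R]_n) H (G (space_chart z)))
  (fun A : 'M[R]_n => A a b)); last exact: coord_continuous.
apply: (@continuous_for_comp _ _ _ _ (fun z => G (space_chart z))
  (fun y => 'D_(delta_mx 0 c : 'rV[R]_n) H y)) => //.
exact: smooth_on_continuous (smooth_on_derive _ sH) (GZ _ variation_dom0).
Qed.

(** The entries are space derivatives of the local expression of the variation, and these are again
    smooth jointly in time and space. *)
Lemma sdiff_differential a b : sdiff p0 (fun z => differential (F z.1) i j z.2 a b).
Proof.
have su := smooth_on_derive ((0 : R^o), (delta_mx 0 a : 'rV[R]_m)) (variation_repr_smooth i j).
apply: near_eq_sdiff (sdiff_smooth 0 b su).
have := near_variation_charts ip jp; apply: filterS => z [te iz jz].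
rewrite (differentialE a b (variation_smooth te) iz jz).
by rewrite -derive_slice_space.
Qed.

Lemma sdiff_epsilon (g : metric M) (h : metric N) r : (r <= m)%N ->
  sdiff p0 (fun z => epsilon r g h (F z.1) z.2).
Proof.
move=> rm.
have Qc := @sdiff_cst R M p0.
have QD := @sdiffD R M p0.
have QM := @sdiffM R M p0.
apply: (@near_eq_sdiff _ _ _ (fun z => (-1) ^+ r * ((\det (g i z.2))^-1 *
    (\det ('X *: map_mx polyC (g i z.2) -
           map_mx polyC (pullback_in (F z.1) h i j z.2)))`_(m - r)))).
  have := near_variation_charts ip jp; apply: filterS => z [te iz jz].
  by rewrite (epsilonE g h rm (variation_smooth te) iz jz).
apply: (QM _ _ (Qc _)); apply: (QM (fun z => (\det (g i z.2))^-1)).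
  (* The only division is by a function independent of time, for which continuity in space is
     enough. *)
  apply: (sdiff_space (v := fun p => (\det (g i p))^-1)).
  apply: continuousV; last exact: metric_det_continuous.
  by rewrite -unitfE -unitmxE metric_unitmx.
apply: (fring_char_poly_mulV (Q := sdiff p0)) => // a b; last first.
  by apply: (sdiff_space (v := fun p => g i p a b)); exact: metric_continuous.
apply: (fring_mulmx (Q := sdiff p0)) => // [k l|k l]; last first.
  by under eq_fun do rewrite mxE; exact: sdiff_differential.
apply: (fring_mulmx (Q := sdiff p0)) => // [k' l'|k' l'].
  exact: sdiff_differential.
exact: sdiff_metric.
Qed.

End AtPoint.
End Variation.

(** * Variations converge in the smooth topology *)

Section SmoothConvergence.
Variables (R : realType) (m n : nat) (M : manifold R m) (N : manifold R n).

Lemma near_time_swap (T : topologicalType) (p : T) (P : R -> T -> Prop) :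
  (\forall z \near ((0 : R), p), P z.1 z.2) ->
  \forall q \near p & t \near (0 : R), P t q.
Proof.
by move=> [[A V] /= [A0 Vp] AVP]; exists (V, A) => // -[q t] /= [Vq At]; exact: (AVP (t, q)).
Qed.

(** The derivatives are taken on the product of time and space, so that joint smoothness gives their
    continuity in both variables. *)
Definition space_partials (W : normedModType R) (s : seq 'I_m)
    (u : (R^o * 'rV[R]_m)%type -> W) : (R^o * 'rV[R]_m)%type -> W :=
  foldr (fun a v z => 'D_((0 : R^o), (delta_mx 0 a : 'rV[R]_m)) v z) u s.

Lemma partials_slice (W : normedModType R) s (u : (R^o * 'rV[R]_m)%type -> W) (t : R) :
  partials s (fun y => u (t, y)) = (fun y => space_partials s u (t, y)).
Proof.
elim: s => [//|a s IH]; rewrite /partials/= -/(partials s _) IH.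
by apply/funext => y; rewrite derive_slice_space.
Qed.

Lemma space_partials_smooth (W : normedModType R) s (U : set (R^o * 'rV[R]_m)%type)
    (u : (R^o * 'rV[R]_m)%type -> W) : smooth_on U u -> smooth_on U (space_partials s u).
Proof. by move=> su; elim: s => [//|a s IH] /=; exact: smooth_on_derive. Qed.

(** Sequences of bounded length over a finite type are encoded as pairs of a length and a tuple,
    which form a finite type. *)
Lemma filter_forall_seq (T : Type) (F : set_system T) (I : finType) (k : nat)
    (P : seq I -> T -> Prop) : Filter F ->
  (forall s, (size s <= k)%N -> F (P s)) ->
  F [set x | forall s, (size s <= k)%N -> P s x].
Proof.
move=> FF FP.
have : F [set x | forall s : {l : 'I_k.+1 & (l : nat).-tuple I}, P (tagged s) x].
  apply: filter_forall => -[l s] /=; apply: FP.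
  by rewrite size_tuple -ltnS ltn_ord.
apply: filterS => x Px s sk; have sk' : (size s < k.+1)%N by [].
by have := Px (Tagged (fun l : 'I_k.+1 => (l : nat).-tuple I) (in_tuple s : (Ordinal sk' : nat).-tuple I)).
Qed.

Variables (phi : smooth_map M N) (e : R) (F : R -> M -> N).
Hypothesis vF : smooth_variation phi e F.

(** Space derivatives of the variation are jointly continuous at (0,p), and compactness of K makes
    the estimate uniform. The quantification over [u] is there because [F t] is a bare function,
    while [B] contains bundled smooth maps. *)
Lemma variation_near_subbasic (B : set (smooth_map M N)) : smooth_subbasic phi B ->
  \forall t \near (0 : R), forall u : smooth_map M N, (u : M -> N) = F t -> B u.
Proof.
move=> [i [j [K [k [d [cK Ki Kj d0 ->]]]]]].
have F0 : F 0 = phi by have [_ ->] := vF.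
pose G := variation_repr F i j.
pose P (t : R) (p : M) := dom N j (F t p) /\ forall s : seq 'I_m, (size s <= k)%N ->
  `|space_partials s G (t, chart M i p) - space_partials s G (0, chart M i p)| < d.
suff : \forall t \near (0 : R), K `<=` P t.
  apply: filterS => t KP u ut p Kp; rewrite ut.
  have [jp sp] := KP p Kp; split=> // s sk.
  have reprE (v : M -> N) t' : v = F t' ->
      local_repr v i j = fun y => G (t', y) by move=> ->.
  by rewrite (reprE phi 0 (esym F0)) (reprE (F t) t erefl) !partials_slice; exact: sp.
move/compact_near_coveringP : cK => /(_ R (nbhs (0 : R)) P _); apply => p Kp.
apply: near_time_swap.
have ip : dom M i p by exact: Ki.
have jp : dom N j (F 0 p) by rewrite F0; exact: Kj.
have near_d s : (size s <= k)%N -> \forall z \near ((0 : R), p),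
    `|space_partials s G (space_chart i z) - space_partials s G (space_chart i (0, z.2))| < d.
  move=> sk.
  have cs : {for ((0 : R), p), continuous (fun z => space_partials s G (space_chart i z))}.
    apply: (@continuous_for_comp _ _ _ _ (space_chart i) (space_partials s G)).
      exact: space_chart_continuous.
    apply: smooth_on_continuous (variation_dom0 vF ip jp).
    exact: space_partials_smooth (variation_repr_smooth vF i j).
  have d20 : 0 < d / 2 by rewrite divr_gt0.
  have h1 : \forall z \near ((0 : R), p),
     `|space_partials s G (space_chart i (0, p)) - space_partials s G (space_chart i z)| < d / 2.
    by have /cvgrPdist_lt/(_ _ d20) := cs.
  have h2 := near_time0 h1.
  near=> z.
  rewrite -(subrKA (space_partials s G (space_chart i (0, p)))) (le_lt_trans (ler_normD _ _))//.
  rewrite [d]splitr ltrD//; last by near: z.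
  by rewrite distrC; near: z.
have near_all : \forall z \near ((0 : R), p), forall s : seq 'I_m, (size s <= k)%N ->
    `|space_partials s G (space_chart i z) - space_partials s G (space_chart i (0, z.2))| < d.
  exact: filter_forall_seq near_d.
have near_c := near_variation_charts vF ip jp.
near=> z; split; last by near: z.
by have [] : [/\ `|z.1| < e, dom M i z.2 & dom N j (F z.1 z.2)] by near: z.
Unshelve. all: by end_near. Qed.

Lemma variation_near_open (O : set (smooth_map M N)) : smooth_topology (N := N) O -> O phi ->
  \forall t \near (0 : R), forall u : smooth_map M N, (u : M -> N) = F t -> O u.
Proof.
move=> oO Ophi; have [l [B [subB BO]]] := oO phi Ophi.
have near_B : \forall t \near (0 : R),
    forall a (u : smooth_map M N), (u : M -> N) = F t -> B a u.
  apply: (@filter_forall R 'I_l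
    (fun a t => forall u : smooth_map M N, (u : M -> N) = F t -> B a u)
    (nbhs (0 : R)) _) => a.
  exact: (variation_near_subbasic (subB a)).
near=> t => u ut; apply: BO => a _.
have : forall a (u : smooth_map M N), (u : M -> N) = F t -> B a u by near: t.
exact.
Unshelve. all: by end_near. Qed.

End SmoothConvergence.

(** * Energy and volume *)

Section Energy.
Variables (R : realType) (r n : nat) (M : manifold R (2 * r)).
Hypothesis cM : compact [set: M].
Variables (N : manifold R n) (h : metric N).

Let r2 : (r <= 2 * r)%N. Proof. by rewrite leq_pmull. Qed.

Lemma vol_fin (g : metric M) : (vol g [set: borel M] < +oo)%E.
Proof.
have [ex|nex] := pselect (exists mu, is_riemannian_measure g mu).
  by apply: riemannian_measure_fin cM (vol_riemannian ex) _ _; exact: measurableT.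
(* The default value of [vol] is the zero measure. *)
by rewrite /vol; case: pselect => // _; rewrite /mzero ltry.
Qed.

Lemma continuous_integrable (g : metric M) (f : M -> R) : continuous f ->
  (vol g).-integrable [set: borel M] (EFin \o f).
Proof.
move=> cf; apply: measurable_bounded_integrable; [exact: measurableT|exact: vol_fin| |].
  exact: continuous_measurable_borel.
have cnf : continuous (fun p => `|f p|).
  move=> p; apply: (@continuous_for_comp _ p _ _ f (fun x : R => `|x|)).
    exact: cf.
  exact: norm_continuous.
have [q _ qmax] : exists2 q, q \in [set: M] & forall t, t \in [set: M] -> `|f t| <= `|f q|.
  by apply: compact_EVT_max => //; [exists point|exact: continuous_subspaceT].
exists `|f q|; split; first exact: normr_real.
by move=> x /ltW fx p _; apply: le_trans fx; apply: qmax; rewrite inE.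
Qed.

Lemma energy_ge_volume (g : metric M) (f : M -> N) : smooth f ->
  2^-1 * ('C(2 * r, r)%:R * volume g h f) <= energy r g h f.
Proof.
move=> fs; rewrite /energy /volume ler_pM2l ?invr_gt0//.
have iv := continuous_integrable g (volume_density_continuous (g := g) (h := h) fs).
rewrite -RintegralZl//; apply: le_Rintegral => //.
- apply: (@continuous_integrable g (fun p => 'C(2 * r, r)%:R * volume_density g h f p)).
  move=> p; apply: (@fring_continuousM R M p (fun=> _)); first exact: cst_continuous.
  exact: volume_density_continuous.
- exact/continuous_integrable/epsilon_continuous.
- by move=> p _; exact: epsilon_ge_volume_density.
Qed.

Lemma energy_eq_volume (g : metric M) (f : M -> N) : smooth f ->
  (forall p, epsilon r g h f p = 'C(2 * r, r)%:R * volume_density g h f p) ->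
  energy r g h f = 2^-1 * ('C(2 * r, r)%:R * volume g h f).
Proof.
move=> fs fE; rewrite /energy /volume.
have iv := continuous_integrable g (volume_density_continuous (g := g) (h := h) fs).
by rewrite -RintegralZl//; congr (_ * _); apply: eq_Rintegral => p _; exact: fE.
Qed.

Lemma near0_opp (P : R -> Prop) : (\forall t \near (0 : R), P t) ->
  \forall t \near (0 : R), P (- t).
Proof.
move=> /nbhs_normP[d d0 dP]; apply/nbhs_normP; exists d => // t /=.
by rewrite sub0r normrN => td; apply: dP; rewrite /= sub0r opprK.
Qed.

(** The increments at t and -t are both nonnegative, so a bound on their sum bounds each of them and
    differentiability at 0 follows. *)
Lemma is_derive_min_symmetric (E : R -> R) : (\forall t \near (0 : R), E 0 <= E t) ->
  (forall k, 0 < k -> \forall t \near (0 : R), E t + E (- t) - 2 * E 0 <= k * `|t|) ->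
  is_derive (0 : R) (1 : R) E 0.
Proof.
move=> Emin Esym; have Emin' := near0_opp Emin.
have key k : 0 < k -> \forall t \near (0 : R), `|E t - E 0| <= k * `|t|.
  move=> k0; have Ek := Esym k k0; near=> t.
  have E0t : E 0 <= E t by near: t.
  have E0Nt : E 0 <= E (- t) by near: t.
  have : E t + E (- t) - 2 * E 0 <= k * `|t| by near: t.
  by rewrite [`|E t - E 0|]ger0_norm ?subr_ge0// => ?; lra.
have cv : (fun k : R => k^-1 *: ((E \o shift 0) (k *: (1 : R)) - E 0)) @ 0^' --> (0 : R).
  apply/cvgr0Pnorm_le => k k0.
  apply: nbhs_dnbhs; apply: filterS (key k k0) => t tk /=.
  rewrite /GRing.scale/= mulr1 addr0 normrM normfV.
  have [->|t0] := eqVneq t 0; first by rewrite normr0 invr0 mul0r ltW.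
  by rewrite mulrC ler_pdivrMr ?normr_gt0.
apply: DeriveDef; first by apply/cvg_ex; exists 0.
exact: cvg_lim cv.
Unshelve. all: by end_near. Qed.

(* The first order terms cancel in the symmetric second difference of the
   energy, which is a sum of two nonnegative terms at a minimum; no derivative
   of the energy density has to be integrated. *)
Lemma near_minimum_r_harmonic (g : metric M) (phi : smooth_map M N) :
  (forall e F, smooth_variation phi e F ->
     \forall t \near (0 : R), energy r g h phi <= energy r g h (F t)) ->
  r_harmonic r g h phi.
Proof.
move=> phimin e F vF.
have [e0 F0 _ _] := vF.
pose V := fine (vol g [set: borel M]).
have V0 : 0 <= V by rewrite fine_ge0.
have Emin := phimin e F vF; rewrite -F0 in Emin.
apply: is_derive_min_symmetric Emin _ => k k0.
(* Integrating the bound d |t| multiplies it by the total volume V; the added 1 excludes division by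
   zero. *)
pose d := k / (V + 1).
have V1 : 0 < V + 1 by rewrite ltr_wpDl.
have d0 : 0 < d by rewrite divr_gt0.
pose S t p := epsilon r g h (F t) p + epsilon r g h (F (- t)) p - 2 * epsilon r g h (F 0) p.
(* The expansion is uniform near each point, and compactness of M yields one time interval for all
   points. *)
have near_S : \forall t \near (0 : R), forall p, `|S t p| <= d * `|t|.
  suff : \forall t \near (0 : R), [set: M] `<=` (fun p => `|S t p| <= d * `|t|).
    by apply: filterS => t St p; exact: St.
  move/compact_near_coveringP : cM.
  move=> /(_ R (nbhs (0 : R)) (fun t p => `|S t p| <= d * `|t|) _); apply => p _.
  apply: (near_time_swap (P := fun t q => `|S t q| <= d * `|t|)).
  have sp := sdiff_epsilon vF (chart_at_dom p) (chart_at_dom (F 0 p)) g h r2.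
  exact: sdiff_symmetric sp d0.
have near_e : \forall t \near (0 : R), `|t| < e.
  by apply/nbhs_normP; exists e => // t; rewrite /= sub0r normrN.
apply: filterS2 near_e near_S => t te St.
have ieps s : `|s| < e -> (vol g).-integrable [set: borel M] (EFin \o epsilon r g h (F s)).
  by move=> se; apply/continuous_integrable/epsilon_continuous/(variation_smooth vF).
have i1 := ieps t te.
have i2 : (vol g).-integrable [set: borel M] (EFin \o epsilon r g h (F (- t))).
  by apply: ieps; rewrite normrN.
have i0 : (vol g).-integrable [set: borel M] (EFin \o epsilon r g h (F 0)).
  by apply: ieps; rewrite normr0.
have i3 : (vol g).-integrable [set: borel M]
    (EFin \o (fun p => epsilon r g h (F t) p + epsilon r g h (F (- t)) p)).
  exact: (integrableD measurableT i1 i2).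
have i4 : (vol g).-integrable [set: borel M] (EFin \o (fun p => 2 * epsilon r g h (F 0) p)).
  exact: (integrableZl measurableT 2 i0).
have -> : energy r g h (F t) + energy r g h (F (- t)) - 2 * energy r g h (F 0) =
    2^-1 * (\int[vol g]_(p in [set: borel M]) S t p)%R.
  have IB := RintegralB measurableT i3 i4.
  have ID := RintegralD measurableT i1 i2.
  have IZ := RintegralZl 2 measurableT i0.
  rewrite [X in _ = 2^-1 * X](etrans IB (congr2 (fun x y => x - y) ID IZ)) /energy.
  have alg (x y z : R) : 2^-1 * x + 2^-1 * y - 2 * (2^-1 * z) = 2^-1 * (x + y - 2 * z) by ring.
  exact: alg.
apply: (@le_trans _ _ (2^-1 * (d * `|t| * V))).
  rewrite ler_pM2l ?invr_gt0// -Rintegral_cst//.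
  apply: le_Rintegral => //.
  - exact: (integrableB measurableT i3 i4).
  - by apply: continuous_integrable; exact: cst_continuous.
  - by move=> p _; exact: le_trans (ler_norm _) (St p).
have -> : 2^-1 * (d * `|t| * V) = (d * V / 2) * `|t| by ring.
rewrite ler_wpM2r// /d ler_pdivrMr// mulrAC ler_pdivrMr//.
nra.
Qed.

End Energy.

(** The local claim is made for an arbitrary topology shared by both functionals. Harmonicity asks
    that it be no finer than the smooth topology, so that every variation enters each neighbourhood
    of [phi] for small times. *)
Theorem corollary2p8 (R : realType) (r n : nat) (hr : (1 <= r)%N)
    (M : manifold R (2 * r)%N) (hM : compact [set: M]) (C : conformal_class M)
    (N : manifold R n) (h : metric N)
    (phi : smooth_map M N) (hphi : r_conformal r C h phi) :
  (forall tau : set (set (smooth_map M N)), is_topology tau ->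
     forall g0 : metric M, in_class C g0 -> local_minimiser tau (volume g0 h) phi ->
     forall g : metric M, in_class C g ->
       local_minimiser tau (energy r g h) phi /\
       (tau `<=` smooth_topology (N := N) -> r_harmonic r g h phi)) /\
  (forall g0 : metric M, in_class C g0 -> global_minimiser (volume g0 h) phi ->
     forall g : metric M, in_class C g ->
       global_minimiser (energy r g h) phi /\ r_harmonic r g h phi).
Proof.
have sm (u : smooth_map M N) : smooth u by exact: smooth_funP.
have phiE g : in_class C g -> forall p,
    epsilon r g h phi p = 'C(2 * r, r)%:R * volume_density g h phi p.
  move=> gC p; have [g1 g1C [U [_ [rho rhoU] rkU]]] := hphi.
  have [c c0 gg1] := (classP g g1C).1 gC.
  have [Up|nUp] := pselect (U p); last exact/epsilon_rank/rkU.
  have [rho0 /(_ _ (chart_at_dom p)) pb] := rhoU p Up.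
  (* Conformality is given for [g1]: from f^*h = rho^2 g1 and g = c g1 comes f^*h = (rho^2 / c)
     g. *)
  apply: (epsilon_conformal (c := rho p ^+ 2 / c p)).
    by rewrite divr_ge0 ?exprn_ge0// ltW.
  by rewrite pb gg1 ?scalerA ?divfK ?gt_eqF//; exact: chart_at_dom.
(* Half the binomial coefficient times the volume bounds the energy from below, with equality at
   [phi]; conformal invariance lets the volumes be compared for [g0]. *)
have compare g0 g (u : smooth_map M N) : in_class C g0 -> in_class C g ->
    volume g0 h phi <= volume g0 h u -> energy r g h phi <= energy r g h u.
  move=> g0C gC le_vol.
  have le_u := @energy_ge_volume R r n M hM N h g u (sm u).
  apply: (le_trans _ le_u).
  rewrite (@energy_eq_volume R r n M hM N h g phi (sm phi) (phiE g gC)).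
  have [c c0 gg0] := (classP g g0C).1 gC.
  have volE (v : smooth_map M N) := volume_conformal hr hM h c0 gg0 (sm v).
  rewrite (volE phi) (volE u).
  have inv2_ge0 : 0 <= 2^-1 :> R by rewrite invr_ge0.
  have bin_ge0 : 0 <= 'C(2 * r, r)%:R :> R by exact: ler0n.
  exact: (ler_wpM2l inv2_ge0 (ler_wpM2l bin_ge0 le_vol)).
split=> [tau _|] g0 g0C minv g gC.
  have [A [tauA Aphi minA]] := minv.
  have minE (u : smooth_map M N) : A u -> energy r g h phi <= energy r g h u.
    by move=> /minA; exact: compare.
  split; first by exists A.
  move=> tau_smooth; apply: near_minimum_r_harmonic => // e F vF.
  have [e0 _ _ _] := vF.
  have near_A := variation_near_open vF (tau_smooth _ tauA) Aphi.
  near=> t.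
  have te : `|t| < e.
    by near: t; apply/nbhs_normP; exists e => // s; rewrite /= sub0r normrN.
  have At : forall u : smooth_map M N, (u : M -> N) = F t -> A u by near: t.
  pose Ft := SmoothMap (variation_smooth vF te).
  exact: (minE Ft (At Ft erefl)).
have minE (u : smooth_map M N) : energy r g h phi <= energy r g h u.
  by apply: compare g0C gC _; exact: minv.
split=> //; apply: near_minimum_r_harmonic => // e F vF.
have [e0 _ _ _] := vF.
near=> t.
have te : `|t| < e.
  by near: t; apply/nbhs_normP; exists e => // s; rewrite /= sub0r normrN.
exact: (minE (SmoothMap (variation_smooth vF te))).
Unshelve. all: by end_near. Qed.
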